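(* Let $N\in\mathbb N$, $p\in[1,\infty)$, and let $\mathcal{X}=\mathcal{X}_1\times\dots\times\mathcal{X}_N$, where each $\mathcal{X}_t$ is a Polish space with a fixed compatible complete metric. If $\mathcal X$ has no isolated points, then the set $$\{\mathbb X\in\mathrm{FP}_p:\ \mathbb X\text{ is Markov and has a representative on a finite probability space}\}$$ is dense in $\mathrm{FP}_p$ (with respect to $\mathcal{AW}_p$). In particular, the plain processes $\Lambda_{\mathrm{plain}}$ are a dense subset of $\mathrm{FP}_p$.
   Context: Let $d_{\mathcal X_t}$ be the metric on $\mathcal X_t$ and $d^p(x,y)=\sum_{t=1}^N d_{\mathcal X_t}^p(x_t,y_t)$ on the product space $\mathcal X$. A filtered process is a tuple $\mathbb{X}=(\Omega^{\mathbb X},\mathcal{F}^{\mathbb X},\mathbb{P}^{\mathbb X},(\mathcal{F}^{\mathbb X}_t)_{t=1}^N,(X_t)_{t=1}^N)$ consisting of a probability space, a filtration on it, and an adapted process $X$ with $X_t$ taking values in $\mathcal X_t$. $\mathcal{FP}_p$ is the class of filtered processes with $\mathbb{E}[d^p(X,x_0)]<\infty$ for some (hence all) $x_0\in\mathcal X$. A coupling of $\mathbb X,\mathbb Y$ is a probability $\pi$ on $(\Omega^{\mathbb X}\times\Omega^{\mathbb Y},\mathcal{F}^{\mathbb X}\otimes\mathcal{F}^{\mathbb Y})$ with marginals $\mathbb{P}^{\mathbb X},\mathbb{P}^{\mathbb Y}$. Identify $\mathcal{F}^{\mathbb X}_t$ and $\mathcal{F}^{\mathbb Y}_t$ with the corresponding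 $\sigma$-algebras on the product space. $\pi$ is causal from $\mathbb X$ to $\mathbb Y$ if, for every $1\le t\le N$, under $\pi$ the $\sigma$-algebras $\mathcal{F}^{\mathbb X}_N$ and $\mathcal{F}^{\mathbb Y}_t$ are conditionally independent given $\mathcal{F}^{\mathbb X}_t$; it is anticausal if the same holds with the roles of $\mathbb X$ and $\mathbb Y$ exchanged; it is bicausal if it is both. Set $\mathcal{AW}_p^p(\mathbb X,\mathbb Y):=\inf_\pi\mathbb{E}_\pi[d^p(X,Y)]$, the infimum being over bicausal couplings. $\mathrm{FP}_p$ is the set of equivalence classes of $\mathcal{FP}_p$ obtained by identifying $\mathbb X,\mathbb Y$ whenever $\mathcal{AW}_p(\mathbb X,\mathbb Y)=0$, equipped with the metric $\mathcal{AW}_p$. A probability space $(\Omega,\mathcal F,\mathbb P)$ is finite if $\Omega$ has finitely many elements. $\mathbb X$ is Markov (in the usual sense, with respect to its filtration) if, for every $1\le t\le N-1$, the conditional law of $X_{t+1}$ given $\mathcal{F}^{\mathbb X}_t$ equals the conditional law of $X_{t+1}$ given $X_t$. A plain process is (the class of) a process of the form $(\mathcal X,\mathcal B(\mathcal X),\mathbb P,(\sigma(X_{1:t}))_{t=1}^N,X)$, where $X$ is the coordinate process on $\mathcal X$, $X_{1:t}=(X_1,\dots,X_t)$, $\mathcal B(\mathcal X)$ is the Borel $\sigma$-algebra, and $\mathbb P\in\mathcal P_p(\mathcal X)$, the set of Borel probabilities on $\mathcal X$ that integrate $d^p(\cdot,x_0)$ for some $x_0\in\mathcal X$. $\Lambda_{\mathrm{plain}}\subseteq\mathrm{FP}_p$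 denotes the set of all plain processes.
   Formalization: ''𝒳 has no isolated points'' is replaced by ''every factor X_t has no isolated points'': with X_1 a single point and X_2=[0,1] the claim fails, since Markov forces X_2 to be independent of F_1. The condition is also imposed on the last factor X_N, where it is not needed. *)

(* Defs.v *)
From HB Require Import structures.
From mathcomp Require Import all_boot all_order all_algebra.
From mathcomp Require Import all_classical all_reals all_analysis.

Set Implicit Arguments.
Unset Strict Implicit.
Unset Printing Implicit Defensive.

Import Order.TTheory GRing.Theory Num.Theory.

Local Open Scope classical_set_scope.
Local Open Scope ring_scope.

(* The times 1, ..., N are indexed by 'I_n.+1 with N = n.+1, so that ord_max is
   the terminal time N. *)

HB.mixin Record isSeparable T & Topological T := {
  separable_subproof : exists2 D : set T, countable D & dense D
}.

(* A (nonempty) Polish space together with a fixed compatible complete metric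
   mdist. Complete is completeness of the uniformity of mdist. *)
#[short(type="polishMetricType")]
HB.structure Definition PolishMetric (R : realType) :=
  { T of Pointed T & Complete T & Metric R T & isSeparable T }.

(* To be required of every factor X_t, not of the product only: if X_1 is a point
   and X_2 = [0, 1], the product has no isolated point, but a Markov process has
   X_2 independent of F_1, and such processes are not dense. *)
Definition no_isolated_points (T : topologicalType) : Prop :=
  isolated [set: T] = set0.

Notation borel T := (g_sigma_algebraType (@open T)).

Section conditioning.
Context d (T : measurableType d) (R : realType) (P : probability T R).

Definition is_cond_prob (G : set (set T)) (A : set T) (f : T -> R) : Prop :=
  [/\ forall B : set R, measurable B -> G (f @^-1` B),
      P.-integrable [set: T] (EFin \o f) &
      forall C, G C -> (\int[P]_(x in C) (f x)%:E = P (A `&` C))%E].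

Definition cond_indep (G H K : set (set T)) : Prop :=
  forall A B, G A -> H B -> forall f g h : T -> R,
    is_cond_prob K A f -> is_cond_prob K B g -> is_cond_prob K (A `&` B) h ->
    {ae P, forall x, h x = f x * g x}.

(* kappa is a regular conditional distribution of Z given G. *)
Definition is_cond_law (S : ptopologicalType) (G : set (set T)) (Z : T -> S)
    (kappa : T -> probability (borel S) R) : Prop :=
  forall B : set (borel S), measurable B ->
    is_cond_prob G (Z @^-1` B) (fun x => fine (kappa x B)).

End conditioning.

Definition gen_by d (T : Type) (S : measurableType d) (Z : T -> S) :
  set (set T) := preimage_set_system [set: T] Z measurable.

Section filtered_processes.
Context (R : realType) (n : nat) (X : 'I_n.+1 -> polishMetricType R).

Record filtered_process := FilteredProcess {
  fp_display : measure_display;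
  fp_space : measurableType fp_display;
  fp_prob : probability fp_space R;
  fp_filt : 'I_n.+1 -> set (set fp_space);
  fp_filt_sigma : forall t, sigma_algebra [set: fp_space] (fp_filt t);
  fp_filt_measurable : forall t, fp_filt t `<=` measurable;
  fp_filt_mono : forall s t : 'I_n.+1, (s <= t)%N -> fp_filt s `<=` fp_filt t;
  fp_proc : forall t, fp_space -> X t;
  fp_adapted : forall t,
    gen_by (fp_proc t : fp_space -> borel (X t)) `<=` fp_filt t
}.

Definition fp_path (x : filtered_process) (w : fp_space x) : prod_topology X :=
  fun t => fp_proc t w.

Definition dist_p (p : R) (x y : prod_topology X) : R :=
  \sum_(t < n.+1) (mdist (x t) (y t)) `^ p.

Definition finite_moment (p : R) d (T : measurableType d)
    (P : probability T R) (Z : T -> prod_topology X) : Prop :=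
  exists x0, (\int[P]_w (dist_p p (Z w) x0)%:E < +oo)%E.

Section couplings.
Variables x y : filtered_process.

Notation product := (fp_space x * fp_space y)%type.

Definition coupling (pi : probability product R) : Prop :=
  (forall A, measurable A -> pi (fst @^-1` A) = fp_prob x A) /\
  (forall B, measurable B -> pi (snd @^-1` B) = fp_prob y B).

Definition lift_filt1 (t : 'I_n.+1) : set (set product) :=
  preimage_set_system [set: product] fst (fp_filt t).

Definition lift_filt2 (t : 'I_n.+1) : set (set product) :=
  preimage_set_system [set: product] snd (fp_filt t).

Definition causal (pi : probability product R) : Prop :=
  forall t, cond_indep pi (lift_filt1 ord_max) (lift_filt2 t) (lift_filt1 t).

Definition anticausal (pi : probability product R) : Prop :=
  forall t, cond_indep pi (lift_filt2 ord_max) (lift_filt1 t) (lift_filt2 t).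

Definition bicausal_coupling : set (probability product R) :=
  [set pi | [/\ coupling pi, causal pi & anticausal pi]].

Definition AW (p : R) : \bar R :=
  ((ereal_inf [set \int[pi]_w (dist_p p (fp_path w.1) (fp_path w.2))%:E
     | pi in bicausal_coupling]) `^ p^-1)%E.

End couplings.

Definition finite_space (x : filtered_process) : Prop :=
  finite_set [set: fp_space x].

(* The conditional law of X_{t+1} given F_t and the one given X_t are only
   determined almost surely; they agree when they have a common version. *)
Definition markov (x : filtered_process) : Prop :=
  forall t : 'I_n, let t0 := widen_ord (leqnSn n) t in let t1 := lift ord0 t in
  exists kappa : fp_space x -> probability (borel (X t1)) R,
    is_cond_law (fp_prob x) (fp_filt t0) (fp_proc t1) kappa /\
    is_cond_law (fp_prob x) (gen_by (fp_proc t0 : fp_space x -> borel (X t0)))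
      (fp_proc t1) kappa.

Section metric_space.
Variable p : R.

Definition calFP := {x : filtered_process | finite_moment p (fp_prob x) (@fp_path x)}.

(* Predicates rather than classical sets: calFP is too large for the universe of
   set. *)
Definition AW_class (x : calFP) : calFP -> Prop :=
  fun y => AW (sval x) (sval y) p = 0%E.

Definition FP := {C : calFP -> Prop | exists x, C = AW_class x}.

Definition to_FP (x : calFP) : FP :=
  exist _ (AW_class x) (ex_intro _ x erefl).

(* Every point of FP is of the form to_FP x, and the distance from to_FP x to
   to_FP y is AW x y. *)
Definition AW_dense (S : FP -> Prop) : Prop :=
  forall (x : calFP) (e : R), 0 < e ->
    exists y : calFP, S (to_FP y) /\ (AW (sval x) (sval y) p < e%:E)%E.

Definition finite_markov : FP -> Prop :=
  fun C => exists x : calFP,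
    [/\ C = to_FP x, markov (sval x) & finite_space (sval x)].

End metric_space.

Section plain.
Variable P : probability (borel (prod_topology X)) R.

Definition coord t : borel (prod_topology X) -> borel (X t) := fun w => w t.

Lemma measurable_coord t : measurable_fun setT (@coord t).
Proof.
apply: (@measurability _ _ _ (borel (X t)) setT (@coord t) (@open (X t))) => //.
move=> _ [B oB <-].
rewrite setTI; apply: sub_gen_smallest.
have cX : continuous (proj t : prod_topology X -> X t) by exact: proj_continuous.
by move/continuousP : cX; apply.
Qed.

Definition coord_filt (t : 'I_n.+1) : set (set (borel (prod_topology X))) :=
  <<s \bigcup_(s in [set s : 'I_n.+1 | (s <= t)%N]) gen_by (@coord s) >>.

Lemma coord_filt_measurable t : coord_filt t `<=` measurable.
Proof.
apply: smallest_sub; first exact: sigma_algebra_measurable.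
move=> _ [s _ [B mB <-]]; exact: measurable_coord.
Qed.

Lemma coord_filt_mono (s t : 'I_n.+1) : (s <= t)%N -> coord_filt s `<=` coord_filt t.
Proof.
move=> st; apply: smallest_sub; first exact: smallest_sigma_algebra.
move=> A [r rs Ar]; apply: sub_gen_smallest; exists r => //=.
exact: leq_trans rs st.
Qed.

Lemma coord_adapted t : gen_by (@coord t) `<=` coord_filt t.
Proof. by move=> A At; apply: sub_gen_smallest; exists t => /=. Qed.

Definition plain : filtered_process :=
  @FilteredProcess _ (borel (prod_topology X)) P coord_filt
    (fun t => @smallest_sigma_algebra _ _ _)
    coord_filt_measurable coord_filt_mono coord coord_adapted.

End plain.

Definition calP (p : R) : set (probability (borel (prod_topology X)) R) :=
  [set P : probability (borel (prod_topology X)) R |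
    finite_moment p P (fun w => w : prod_topology X)].

Definition plain_calFP (p : R) P (PP : calP p P) : calFP p :=
  exist _ (plain P) PP.

Definition Lambda_plain (p : R) : FP p -> Prop :=
  fun C => exists P (PP : calP p P), C = to_FP (plain_calFP PP).

End filtered_processes.

(* Main.v *)
(* Quantize each [X_t] to a finite-valued F_t-measurable variable [r_t]. Going
   backwards in time, refine [r_t] to a finite-valued F_t-measurable state [q_t]
   that also records a discretization of the numbers P(q_(t+1) = j | F_t); these
   are then dominated, up to a factor 1 - dl, by a kernel k_t(q_t, j).

   Couple [X] with the Markov chain [s] with kernel [k_t] started from [q_0] by
   letting it move from [i] to [j], given F_(t+1), with probability
     k_t(i, j) + (1 - dl) 1[q_t = i] (1[q_(t+1) = j] - P(q_(t+1) = j | F_t)).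
   This is F_(t+1)-measurable, which makes the coupling causal, and averages to
   k_t(i, j) given F_t, which makes it anticausal; moreover [s = q] with
   probability at least 1 - n dl. Since no factor has isolated points, states can
   be given distinct values [f_t(s_t)] close to those of [r_t]: the resulting
   process generates the filtration of the chain, so it is Markov, and it is the
   plain process of its law. *)
Require Import Defs.
From HB Require Import structures.
From mathcomp Require Import all_boot all_order all_algebra.
From mathcomp Require Import all_classical all_reals all_analysis.
From mathcomp Require Import measurable_realfun ring lra.

Set Implicit Arguments.
Unset Strict Implicit.
Unset Printing Implicit Defensive.

Import Order.TTheory GRing.Theory Num.Theory.

Local Open Scope classical_set_scope.
Local Open Scope ring_scope.

(** * Conditional probabilities given a sub-sigma-algebra *)

(** Bicausal couplings see filtrations, so quantizing the values is not enough: a state must also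
    carry what F_t knows about the next state, whence the backward recursion. It can carry this only
    approximately, since P(q_(t+1) = j | F_t) may take a continuum of values. Hence [q] need not be
    Markov, and copying [q] outright would in general not be anticausal. The slack [dl] pays for the
    discrepancy: the domination has to be multiplicative, because it is what keeps the moving
    probabilities nonnegative, and an additive error would spoil this where [k] is small. The order
    of the choices matters. The quantization points, hence the largest cost of a wrong state, are
    fixed before [dl], and [dl] before the number of states: refining [q] adds states but no new
    quantization points, so the cost of leaving [q] stays bounded while its probability is made
    small. The distinct values near the quantization points are chosen last. *)

Section sub_sigma_algebra.
Context d (T : measurableType d) (R : realType) (P : probability T R).
Variable K : set (set T).
Hypothesis sK : sigma_algebra [set: T] K.
Hypothesis mK : K `<=` measurable.

Definition sub_measurable (f : T -> R) :=
  forall B : set R, measurable B -> K (f @^-1` B).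

Local Notation TK := (g_sigma_algebraType K).

Lemma sub_algebraE : (measurable : set (set TK)) = K.
Proof. exact: sigma_algebra_id. Qed.

Lemma sub_setT : K setT.
Proof. by rewrite -sub_algebraE; exact: measurableT. Qed.

Lemma sub_setC A : K A -> K (~` A).
Proof. by rewrite -sub_algebraE; exact: measurableC. Qed.

Lemma sub_setI A B : K A -> K B -> K (A `&` B).
Proof. by rewrite -sub_algebraE; exact: measurableI. Qed.

Lemma sub_bigcap_fin (I : finType) (A : I -> set T) :
  (forall i, K (A i)) -> K (\bigcap_i A i).
Proof.
rewrite -sub_algebraE => KA.
apply: (@fin_bigcap_measurable _ TK _ setT) => //.
Qed.

Lemma sub_bigcup_fin (I : finType) (A : I -> set T) :
  (forall i, K (A i)) -> K (\bigcup_i A i).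
Proof.
rewrite -sub_algebraE => KA.
apply: (@fin_bigcup_measurable _ TK _ setT) => //.
Qed.

Lemma sub_measurableP f :
  sub_measurable f <-> @measurable_fun _ _ TK R setT f.
Proof.
split=> [mf _ B mB|mf B mB].
  rewrite setTI /=; change ((measurable : set (set TK)) (f @^-1` B)).
  by rewrite sub_algebraE; exact: mf.
by rewrite -sub_algebraE -[X in measurable X](@setTI TK); exact: mf.
Qed.

Lemma sub_measurableW f : sub_measurable f -> measurable_fun setT f.
Proof. by move=> mf _ B mB; rewrite setTI; apply: mK; exact: mf. Qed.

Lemma sub_measurable_cst (c : R) : sub_measurable (cst c).
Proof. by apply/sub_measurableP; exact: measurable_cst. Qed.

Lemma sub_measurableD f g :
  sub_measurable f -> sub_measurable g -> sub_measurable (fun x => f x + g x).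
Proof.
move=> /sub_measurableP mf /sub_measurableP mg; apply/sub_measurableP.
exact: measurable_funD.
Qed.

Lemma sub_measurableB f g :
  sub_measurable f -> sub_measurable g -> sub_measurable (fun x => f x - g x).
Proof.
move=> /sub_measurableP mf /sub_measurableP mg; apply/sub_measurableP.
exact: measurable_funB.
Qed.

Lemma sub_measurableM f g :
  sub_measurable f -> sub_measurable g -> sub_measurable (fun x => f x * g x).
Proof.
move=> /sub_measurableP mf /sub_measurableP mg; apply/sub_measurableP.
exact: measurable_funM.
Qed.

Lemma sub_measurable_sum (I : Type) (r : seq I) (p : pred I) (f : I -> T -> R) :
  (forall i, p i -> sub_measurable (f i)) ->
  sub_measurable (fun x => \sum_(i <- r | p i) f i x).
Proof.
move=> mf; elim: r => [|i r ih].
  rewrite (_ : (fun _ => _) = cst 0); last by apply/funext => x; rewrite big_nil.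
  exact: sub_measurable_cst.
case pi : (p i); last first.
  by rewrite (_ : (fun _ => _) = fun x => \sum_(j <- r | p j) f j x) //;
    apply/funext => x; rewrite big_cons pi.
rewrite (_ : (fun _ => _) = fun x => f i x + \sum_(j <- r | p j) f j x).
  by apply: sub_measurableD => //; exact: mf.
by apply/funext => x; rewrite big_cons pi.
Qed.

Lemma sub_measurable_indic A : K A -> sub_measurable (\1_A : T -> R).
Proof.
by move=> KA; apply/sub_measurableP; apply: measurable_indic; rewrite sub_algebraE.
Qed.

(** Makes [K] the full sigma-algebra of a measurable space, where Radon-Nikodym and the uniqueness
    of densities are available; [sub_prob], the image of [P], is the restriction of [P] to [K]. *)
Definition id_sub : T -> TK := id.

Lemma measurable_id_sub : measurable_fun setT id_sub.
Proof. by move=> _ B; rewrite setTI sub_algebraE => KB; exact: mK. Qed.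

HB.instance Definition _ := isMeasurableFun.Build _ _ _ _ id_sub measurable_id_sub.

Definition sub_prob : probability TK R := distribution P id_sub.

Lemma integral_sub_prob f C : sub_measurable f -> P.-integrable setT (EFin \o f) ->
  K C -> (\int[sub_prob]_(x in C) (f x)%:E = \int[P]_(x in C) (f x)%:E)%E.
Proof.
move=> mf intf KC.
rewrite (@integral_pushforward _ _ _ _ _ _ measurable_id_sub P C (EFin \o f)) //.
- by apply/measurable_EFinP/sub_measurableP.
- by apply: integrableS intf => //; exact: mK.
- by rewrite sub_algebraE.
Qed.

Lemma sub_prob_integrable f : sub_measurable f -> P.-integrable setT (EFin \o f) ->
  sub_prob.-integrable setT (EFin \o f).
Proof.
move=> mf intf.
apply: (@integrable_pushforward _ _ _ _ _ _ measurable_id_sub P setT (EFin \o f)) => //.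
by apply/measurable_EFinP/sub_measurableP.
Qed.

(** Densities with respect to the restriction of [P] to [K] are unique almost everywhere, and an
    exceptional set that is null for the restriction is null for [P]. *)
Lemma cond_prob_uniq f g : sub_measurable f -> sub_measurable g ->
  P.-integrable setT (EFin \o f) -> P.-integrable setT (EFin \o g) ->
  (forall C, K C -> \int[P]_(x in C) (f x)%:E = \int[P]_(x in C) (g x)%:E)%E ->
  {ae P, forall x, f x = g x}.
Proof.
move=> mf mg intf intg fg.
have [N [mN N0 sN]] : ae_eq sub_prob setT (EFin \o f) (EFin \o g).
  apply: integral_ae_eq => //.
  - exact: sub_prob_integrable.
  - by apply/measurable_EFinP/sub_measurableP.
  - move=> E _; rewrite sub_algebraE => KE.
    by rewrite !integral_sub_prob// fg.
exists N; split => //.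
- by apply: mK; rewrite -sub_algebraE.
- by apply: subset_trans sN => x /= fgx /(_ I) [].
Qed.

Section trace.
Variables (A : set T) (mA : measurable A).

Definition trace (C : set TK) : \bar R := P (A `&` C).

Let trace0 : trace set0 = 0%E. Proof. by rewrite /trace setI0 measure0. Qed.

Let trace_ge0 C : (0 <= trace C)%E. Proof. exact: measure_ge0. Qed.

Let trace_additive : semi_sigma_additive trace.
Proof.
move=> F mF tF mU; rewrite /trace setI_bigcupr.
have mF' i : measurable (F i : set T) by apply: mK; rewrite -sub_algebraE.
apply: measure_semi_sigma_additive.
- by move=> i; exact: measurableI.
- apply/trivIsetP => i j _ _ ij.
  by move/trivIsetP : tF => /(_ i j I I ij); rewrite setIACA => ->; rewrite setI0.
- by apply: bigcup_measurable => i _; exact: measurableI.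
Qed.

HB.instance Definition _ := isMeasure.Build _ _ _ trace trace0 trace_ge0 trace_additive.

Let trace_fin : fin_num_fun trace.
Proof.
move=> C; rewrite sub_algebraE => KC.
by apply: fin_num_measure; apply: measurableI => //; exact: mK.
Qed.

HB.instance Definition _ := Measure_isFinite.Build _ _ _ trace trace_fin.

(** The conditional probability is the Radon-Nikodym derivative of [trace] with respect to
    [sub_prob]. *)
Lemma cond_prob_ex :
  exists2 f, is_cond_prob P K A f & forall x, 0 <= f x.
Proof.
have dom : trace `<< sub_prob.
  apply/null_content_dominatesP => C; rewrite sub_algebraE => KC PC0.
  apply/eqP; rewrite -measure_le0 -[X in (_ <= X)%E]PC0.
  by apply: le_measure; rewrite ?inE//; [apply: measurableI => //|]; exact: mK.
pose f := Radon_Nikodym_SigmaFinite.f trace sub_prob.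
have ff x : f x \is a fin_num by exact: Radon_Nikodym_SigmaFinite.f_fin_num.
have fE : (EFin \o (fine \o f)) = f by apply/funext => x /=; rewrite fineK.
have intf : sub_prob.-integrable setT (EFin \o (fine \o f)).
  by rewrite fE; exact: Radon_Nikodym_SigmaFinite.f_integrable.
have mf : sub_measurable (fine \o f).
  by apply/sub_measurableP/measurable_EFinP; exact: measurable_int intf.
have intf' : P.-integrable setT (EFin \o (fine \o f)).
  move/integrableP : intf => [m1 m2]; apply/integrableP; split.
    by apply/measurable_EFinP; exact: sub_measurableW.
  move: m2.
  rewrite (@ge0_integral_pushforward _ _ _ _ _ _ measurable_id_sub P setT
     (fun x => `|(EFin \o (fine \o f)) x|)%E) //.
  exact: measurableT_comp.
exists (fine \o f); last first.
  by move=> x; apply/fine_ge0/Radon_Nikodym_SigmaFinite.f_ge0.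
split => // C KC.
rewrite -integral_sub_prob//.
have -> : P (A `&` C) = trace C by [].
rewrite (Radon_Nikodym_SigmaFinite.f_integral dom) ?sub_algebraE//.
by apply: eq_integral => x _ /=; rewrite fineK.
Qed.

End trace.

End sub_sigma_algebra.

(** * Pulling bounded factors out of conditional expectations; a criterion for conditional
    independence *)

Section real_integrals.
Context d (T : measurableType d) (R : realType) (P : probability T R).
Implicit Types (f g b : T -> R) (A C : set T).

Local Notation L1 f := (P.-integrable [set: T] (EFin \o f)).

Lemma integrable_mul_bounded f b c : L1 f -> measurable_fun setT b ->
  (forall x, `|b x| <= c) -> L1 (fun x => f x * b x).
Proof.
move=> intf mb bc.
rewrite (_ : _ \o _ = (EFin \o f) \* (EFin \o b))%E.
  apply: integrableMl => //.
  exists c; split; first exact: num_real.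
  by move=> M cM x _; exact: le_trans (bc x) (ltW cM).
by apply/funext => x /=; rewrite EFinM.
Qed.

Lemma bounded_integrable b c : measurable_fun setT b ->
  (forall x, `|b x| <= c) -> L1 b.
Proof.
move=> mb bc.
have := @integrable_mul_bounded (cst 1) b c _ mb bc.
rewrite (_ : (fun _ => _) = b); last by apply/funext => x; rewrite mul1r.
by apply; apply: finite_measure_integrable_cst.
Qed.

Lemma RintegralT_fin f C : L1 f -> measurable C ->
  ((\int[P]_(x in C) f x)%:E = \int[P]_(x in C) (f x)%:E)%E.
Proof.
move=> intf mC; rewrite fineK//; apply: integrable_fin_num => //.
exact: integrableS intf.
Qed.

Lemma integrable_sumR (I : Type) (r : seq I) (p : pred I) (F : I -> T -> R) :
  (forall i, p i -> L1 (F i)) -> L1 (fun x => \sum_(i <- r | p i) F i x).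
Proof.
move=> intF.
rewrite (_ : _ \o _ = fun x => (\sum_(i <- r | p i) (EFin \o F i) x)%E).
  exact: integrable_sum.
by apply/funext => x /=; rewrite sumEFin.
Qed.

Lemma integrable_scaleR (c : R) f : L1 f -> L1 (fun x => c * f x).
Proof. exact: integrableZl. Qed.

Lemma integrable_subR f g : L1 f -> L1 g -> L1 (fun x => f x - g x).
Proof.
move=> intf intg.
rewrite (_ : _ \o _ = (EFin \o f) \- (EFin \o g))%E//.
exact: integrableB.
Qed.

Lemma integrable_addR f g : L1 f -> L1 g -> L1 (fun x => f x + g x).
Proof.
move=> intf intg.
rewrite (_ : _ \o _ = (EFin \o f) \+ (EFin \o g))%E//.
exact: integrableD.
Qed.

Lemma integrable_onR f C : measurable C -> L1 f -> P.-integrable C (EFin \o f).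
Proof. by move=> mC; apply: (integrableS measurableT). Qed.

Lemma Rintegral_mul_indic f A C : measurable A -> measurable C ->
  \int[P]_(x in C) (f x * \1_A x) = \int[P]_(x in C `&` A) f x.
Proof.
move=> mA mC; rewrite Rintegral_mkcondr; apply: eq_Rintegral => x _.
by rewrite patchE indicE; case: ifP => _; rewrite ?mulr1 ?mulr0.
Qed.

Lemma Rintegral_indic A C : measurable A -> measurable C ->
  \int[P]_(x in C) (\1_A x) = fine (P (A `&` C)).
Proof. by move=> mA mC; rewrite /Rintegral integral_indic// setIC. Qed.

Lemma Rintegral_sum (I : Type) (r : seq I) (p : pred I) (F : I -> T -> R) C :
  measurable C -> (forall i, p i -> L1 (F i)) ->
  \int[P]_(x in C) (\sum_(i <- r | p i) F i x) =
  \sum_(i <- r | p i) \int[P]_(x in C) F i x.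
Proof.
move=> mC intF.
have intC g : L1 g -> P.-integrable C (EFin \o g) by exact: integrable_onR.
elim: r => [|i r ih].
  rewrite big_nil; under eq_Rintegral do rewrite big_nil.
  by rewrite Rintegral_cst// mul0r.
rewrite big_cons -ih; under eq_Rintegral do rewrite big_cons.
by case: ifP => // pi; rewrite RintegralD//; apply: intC; [exact: intF|exact: integrable_sumR].
Qed.

Lemma integral_cstT (c : R) : (\int[P]_x c%:E = c%:E)%E.
Proof.
by rewrite integral_cst// -[RHS]mule1; congr (_ * _)%E; exact: probability_setT.
Qed.

Section step.
Variables (b : T -> R) (b01 : forall x, 0 <= b x <= 1).

Let level (N k : nat) : set T := b @^-1` `[k%:R / N%:R, k.+1%:R / N%:R[.

(** Exactly one layer contains [x], so the sum rounds [b x] down to a multiple of 1/N. The layers go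
    up to index [N] because [b x] may equal 1. *)
Lemma step_approx N x : (0 < N)%N ->
  `|b x - \sum_(k < N.+1) k%:R / N%:R * \1_(level N k) x| <= N%:R^-1.
Proof.
move=> N0; have NR : 0 < N%:R :> R by rewrite ltr0n.
have /andP[b0 b1] := b01 x.
pose k := Num.truncn (N%:R * b x).
have /truncn_itv /andP[kl ku] : 0 <= N%:R * b x by rewrite mulr_ge0// ltW.
have kN : (k < N.+1)%N.
  by rewrite ltnS -(ler_nat R) (le_trans kl)// ler_piMr// ltW.
have lev (j : nat) : \1_(level N j) x = (j == k)%:R :> R.
  rewrite indicE; suff -> : (x \in level N j) = (j == k) by [].
  rewrite -[LHS]/(x \in [set x | b x \in `[j%:R / N%:R, j.+1%:R / N%:R[]).
  apply/idP/eqP; rewrite inE /= in_itv /= ler_pdivrMr// ltr_pdivlMr// [b x * _]mulrC;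
    [move=> /andP[j1 j2]|move=> ->]; last by rewrite kl ku.
  apply/eqP; rewrite eqn_leq -[X in X && _]ltnS -[X in _ && X]ltnS -!(ltr_nat R).
  by rewrite (le_lt_trans j1 ku) (le_lt_trans kl j2).
rewrite (bigD1 (Ordinal kN)) //= lev eqxx mulr1 big1 ?addr0; last first.
  by move=> i; rewrite -val_eqE /= => /negbTE ik; rewrite lev ik mulr0.
rewrite ger0_norm ?subr_ge0 ?ler_pdivrMr ?[b x * _]mulrC//.
rewrite lerBlDr -[in X in X + _](mul1r (N%:R^-1)) -mulrDl ler_pdivlMr// mulrC.
by rewrite addrC natr1 ltW.
Qed.

End step.

(** Rounding [b] down to multiples of 1/N leaves a combination of indicators of sets of [K], against
    which [f] integrates to zero; the error is at most the integral of the absolute value of [f]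
    over [C], divided by [N]. *)
Lemma bounded_pullout K f b C : sigma_algebra setT K -> K `<=` measurable ->
  L1 f -> (forall D, K D -> \int[P]_(x in D) f x = 0) ->
  sub_measurable K b -> (forall x, 0 <= b x <= 1) -> K C ->
  \int[P]_(x in C) (f x * b x) = 0.
Proof.
move=> sK mK intf f0 mb b01 KC; have mC := mK _ KC.
have mbT : measurable_fun setT b := sub_measurableW mK mb.
have intC g : L1 g -> P.-integrable C (EFin \o g) by exact: integrable_onR.
have intfb : L1 (fun x => f x * b x).
  apply: (@integrable_mul_bounded _ _ 1) => // x.
  by have /andP[b0 b1] := b01 x; rewrite ger0_norm.
pose Ab := \int[P]_(x in C) `|f x|.
have Ab0 : 0 <= Ab by apply: Rintegral_ge0 => x _.
suff H N : (0 < N)%N -> `|\int[P]_(x in C) (f x * b x)| <= Ab / N%:R.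
  apply/eqP; rewrite -normr_le0; apply/ler_addgt0Pr => e e0; rewrite add0r.
  pose N := (Num.truncn (Ab / e)).+1.
  apply: (le_trans (H N isT)).
  rewrite ler_pdivrMr ?ltr0n// mulrC -ler_pdivrMr//.
  by rewrite ltW// truncnS_gt.
move=> N0.
pose lv k := b @^-1` `[k%:R / N%:R, k.+1%:R / N%:R[%classic.
have Klv k : K (lv k) by apply: mb; exact: measurable_itv.
have mlv k : measurable (lv k) by exact: mK.
pose s x : R := \sum_(k < N.+1) k%:R / N%:R * \1_(lv k) x.
have sE : (fun x => f x * s x) =
    fun x => \sum_(k < N.+1) (k%:R / N%:R) * (f x * \1_(lv k) x).
  by apply/funext => x; rewrite mulr_sumr; apply: eq_bigr => k _; rewrite mulrCA.
have intfi k : L1 (fun x => f x * \1_(lv k) x).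
  apply: (@integrable_mul_bounded _ _ 1) => // x.
  by rewrite indicE; case: (_ \in _); rewrite ?normr1 ?normr0.
have intfs : L1 (fun x => f x * s x).
  by rewrite sE; apply: integrable_sumR => k _; exact: integrable_scaleR.
have -> : \int[P]_(x in C) (f x * b x) = \int[P]_(x in C) (f x * b x - f x * s x).
  rewrite RintegralB//; [|exact: intC..].
  rewrite [X in _ - X](_ : _ = 0) ?subr0// sE Rintegral_sum//.
    rewrite big1// => k _; rewrite RintegralZl//; last exact: intC.
    by rewrite Rintegral_mul_indic// f0 ?mulr0//; exact: sub_setI.
  by move=> k _; exact: integrable_scaleR.
have intd : L1 (fun x => f x * b x - f x * s x).
  exact: integrable_subR.
apply: (le_trans (le_normr_Rintegral mC (intC _ intd))).
have intn g : L1 g -> L1 (fun x => `|g x|).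
  by move=> intg; rewrite (_ : _ \o _ = abse \o (EFin \o g)) //; exact: integrable_abse.
rewrite /Ab -RintegralZr//; last by apply/intC/intn.
apply: le_Rintegral => //; first by apply/intC/intn.
  apply: intC; apply: (@integrable_mul_bounded _ _ N%:R^-1) => //; first exact: intn.
  by move=> x /=; rewrite ger0_norm.
move=> x _; rewrite -mulrBr normrM ler_wpM2l//.
exact: step_approx.
Qed.

Lemma bounded_pullout_scaled K f b c C : sigma_algebra setT K -> K `<=` measurable ->
  L1 f -> (forall D, K D -> \int[P]_(x in D) f x = 0) ->
  sub_measurable K b -> (forall x, 0 <= b x <= c) -> K C ->
  \int[P]_(x in C) (f x * b x) = 0.
Proof.
move=> sK mK intf f0 mb b0c KC.
(* Rescaling by [c + 1] instead of [c] covers the case c = 0. *)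
have c1 : 0 < c + 1.
  by have /andP[b0 bc] := b0c point; rewrite ltr_wpDl// (le_trans b0).
pose b' x := (c + 1)^-1 * b x.
have mb' : sub_measurable K b'.
  by apply: sub_measurableM => //; exact: sub_measurable_cst.
have b'01 x : 0 <= b' x <= 1.
  have /andP[b0 bc] := b0c x.
  rewrite mulr_ge0 ?invr_ge0 ?(ltW c1)//= /b' mulrC ler_pdivrMr// mul1r.
  by rewrite (le_trans bc)// lerDl.
transitivity (\int[P]_(x in C) ((c + 1) * (f x * b' x))).
  by apply: eq_Rintegral => x _; rewrite /b' mulrCA mulVKf// gt_eqF.
rewrite RintegralZl; last 2 first.
- exact: mK.
- apply: integrable_onR; first exact: mK.
  apply: (@integrable_mul_bounded _ _ 1) => //; first exact: sub_measurableW mb'.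
  by move=> x; have /andP[? ?] := b'01 x; rewrite ger0_norm.
by rewrite (bounded_pullout sK mK)// mulr0.
Qed.

(** [phi] is a version of the conditional probability of [A] given [H] and [K] together that depends
    on [K] only; pulling it out gives P(A and B | K) = phi P(B | K). The criterion treats [G] and
    [H] differently, so both orders are concluded and it can be checked from the convenient side. *)
Lemma cond_indep_crit (G H K : set (set T)) :
  sigma_algebra setT K -> G `<=` measurable -> H `<=` measurable ->
  K `<=` measurable -> H setT ->
  (forall A, G A -> exists c (phi : T -> R),
     [/\ sub_measurable K phi, forall x, 0 <= phi x <= c &
     forall B C, H B -> K C ->
       \int[P]_(x in C `&` B) phi x = fine (P (A `&` B `&` C))]) ->
  cond_indep P G H K /\ cond_indep P H G K.
Proof.
move=> sK mG mH mK HT crit.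
suff ci : cond_indep P G H K.
  split=> // A B HA GB f g h cf cg ch.
  have := ci _ _ GB HA g f h cg cf; rewrite setIC => /(_ ch).
  by apply: filterS => x ->; rewrite mulrC.
move=> A B GA HB f g h [mf intf fE] [mg intg gE] [mh inth hE].
have [c [phi [mphi phi01 phiE]]] := crit _ GA.
have mA := mG _ GA; have mB := mH _ HB.
have phib x : `|phi x| <= c by have /andP[? ?] := phi01 x; rewrite ger0_norm.
have mphiT := sub_measurableW mK mphi.
have intphi : L1 phi by apply: (@bounded_integrable _ c).
have fphi : {ae P, forall x, f x = phi x}.
  apply: (cond_prob_uniq sK mK) => // C KC.
  rewrite fE// -RintegralT_fin//; last exact: mK.
  have := phiE _ _ HT KC; rewrite !setIT => ->.
  by rewrite fineK// fin_num_measure//; apply: measurableI => //; exact: mK.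
have intM u : L1 u -> L1 (fun x => u x * phi x).
  by move=> intu; apply: (@integrable_mul_bounded _ _ c).
have hphi : {ae P, forall x, h x = g x * phi x}.
  apply: (cond_prob_uniq sK mK) => //.
  - exact: sub_measurableM.
  - exact: intM.
  move=> C KC; have mC := mK _ KC.
  have int1B : L1 (\1_B : T -> R) by exact: integrable_indic.
  have intC u : L1 u -> P.-integrable C (EFin \o u) by exact: integrable_onR.
  rewrite hE// -RintegralT_fin//; last exact: intM.
  have -> : \int[P]_(x in C) (g x * phi x) = \int[P]_(x in C) (phi x * \1_B x).
    apply/eqP; rewrite -subr_eq0 -RintegralB//; first last.
    - apply/intC; have := intM _ int1B.
      rewrite (_ : (fun x => \1_B x * phi x) = (fun x => phi x * \1_B x))//.
      by apply/funext => x; rewrite mulrC.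
    - by apply/intC/intM.
    apply/eqP; under eq_Rintegral do rewrite [phi _ * _]mulrC -mulrBl.
    apply: (bounded_pullout_scaled (c := c) sK mK) => //.
      exact: integrable_subR.
    move=> D KD; have mD := mK _ KD.
    rewrite RintegralB//; [|exact: integrable_onR..].
    by rewrite Rintegral_indic// /Rintegral gE// subrr.
  rewrite Rintegral_mul_indic// phiE// fineK//.
  by apply: fin_num_measure; apply: measurableI => //; exact: measurableI.
by apply: filterS2 fphi hphi => x -> ->; rewrite mulrC.
Qed.

End real_integrals.

(** * Paths of a finite-state Markov chain *)

Section paths.
Context (R : realType) (n M : nat).

Local Notation path := {ffun 'I_n.+1 -> 'I_M.+1}.
Implicit Types (s : path) (t : nat).

(** The classes of [agree t] are the atoms of the filtration of the chain at time [t]. *)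
Definition agree t s s' := [forall v : 'I_n.+1, (v <= t)%N ==> (s v == s' v)].

Lemma agreeP t s s' :
  reflect (forall v : 'I_n.+1, (v <= t)%N -> s v = s' v) (agree t s s').
Proof.
apply: (iffP forallP) => [h v vt|h v]; first by apply/eqP; exact: (implyP (h v)).
by apply/implyP => vt; rewrite h.
Qed.

Lemma agree_refl t s : agree t s s. Proof. exact/agreeP. Qed.

Lemma agree_sym t s s' : agree t s s' = agree t s' s.
Proof. by apply/agreeP/agreeP => h v vt; rewrite h. Qed.

Lemma agree_trans t s s' s'' : agree t s s' -> agree t s' s'' -> agree t s s''.
Proof. by move=> /agreeP h /agreeP h'; apply/agreeP => v vt; rewrite h// h'. Qed.

Lemma agree_le t t' s s' : (t' <= t)%N -> agree t s s' -> agree t' s s'.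
Proof. by move=> tt /agreeP h; apply/agreeP => v vt; apply/h/(leq_trans vt). Qed.

Lemma agree_last s s' : agree n s s' = (s == s').
Proof.
apply/idP/eqP => [/agreeP h|->]; last exact: agree_refl.
by apply/ffunP => v; apply: h; rewrite -ltnS.
Qed.

Lemma agree_inord t u s s' : (t <= n)%N -> (u <= t)%N -> agree t s s' ->
  s (inord u) = s' (inord u).
Proof. by move=> tn ut /agreeP; apply; rewrite inordK// ltnS (leq_trans ut). Qed.

Definition set_at s t j : path := [ffun i => if i == inord t then j else s i].

Lemma agree_set_at t j s s' : (t < n)%N ->
  agree t.+1 (set_at s t.+1 j) s' = agree t s s' && (s' (inord t.+1) == j).
Proof.
move=> tn; apply/agreeP/andP => [h|[/agreeP h /eqP hj] v vt].
  split; last first.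
    by rewrite -h ?ffunE ?eqxx// inordK.
  apply/agreeP => v vt; rewrite -h ?ffunE; last exact: leqW.
  by rewrite -val_eqE /= inordK// ltn_eqF.
rewrite ffunE; case: eqVneq => [->//|].
by rewrite -val_eqE /= inordK// => vt'; apply: h; rewrite -ltnS ltn_neqAle vt'.
Qed.

Variable k : nat -> 'I_M.+1 -> 'I_M.+1 -> R.

(** The probability that a chain with kernel [k], having followed [s] up to time [t], follows it to
    the end. It is used with the deterministic kernel and with the random kernel [move]. *)
Definition tail_weight t s :=
  \prod_(t <= u < n) k u (s (inord u)) (s (inord u.+1)).

Lemma tail_weightS t s : (t < n)%N ->
  tail_weight t s = k t (s (inord t)) (s (inord t.+1)) * tail_weight t.+1 s.
Proof. by move=> tn; rewrite /tail_weight big_ltn. Qed.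

Hypothesis k1 : forall t i, (t < n)%N -> \sum_j k t i j = 1.

(** The class of [s] is split by the state at time [t.+1], and on each piece the later factors sum
    to one. This last fact is a hypothesis so that the lemma can drive the induction that proves
    it. *)
Lemma tail_weight_next t s (g : 'I_M.+1 -> R) : (t < n)%N ->
  (forall s', \sum_(s'' | agree t.+1 s' s'') tail_weight t.+1 s'' = 1) ->
  \sum_(s' | agree t s s') tail_weight t s' * g (s' (inord t.+1)) =
  \sum_j k t (s (inord t)) j * g j.
Proof.
move=> tn ih.
rewrite (partition_big (fun s' : path => s' (inord t.+1)) xpredT)//=.
apply: eq_bigr => j _.
transitivity (\sum_(s' | agree t.+1 (set_at s t.+1 j) s')
    k t (s (inord t)) j * g j * tail_weight t.+1 s'); last first.
  by rewrite -mulr_sumr ih mulr1.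
apply: eq_big => [s'|s' /andP[ss' /eqP s'j]]; first by rewrite agree_set_at.
rewrite tail_weightS// s'j (agree_inord _ (leqnn t) ss') 1?ltnW//.
by rewrite -!mulrA; congr (_ * _); rewrite mulrC.
Qed.

Lemma tail_weight_sum t s : (t <= n)%N ->
  \sum_(s' | agree t s s') tail_weight t s' = 1.
Proof.
(* Induction on the number [n - t] of remaining steps; with none left, the class of [s] is [s] alone
   and the product is empty. *)
move=> tn; move: s; rewrite -(subKn tn); move: (n - t)%N (leq_subr t n) => i.
elim: i => [_ s|i ih ni s].
  rewrite subn0 (big_pred1 s) => [|s']; first by rewrite /tail_weight big_geq.
  by rewrite agree_last eq_sym.
have ni' : (n - i.+1 < n)%N by rewrite -subSn// subSS leq_subr.
have niE : (n - i.+1).+1 = (n - i)%N by rewrite -subSn// subSS.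
have := tail_weight_next s (fun=> 1) ni'.
rewrite niE => /(_ (ih (ltnW ni))).
under eq_bigr do rewrite mulr1.
by under [in X in _ = X -> _]eq_bigr do rewrite mulr1; rewrite k1.
Qed.

Lemma agree_exchange t (C : pred path) (g : path -> path -> R) :
  (forall s s', agree t s s' -> C s = C s') ->
  \sum_(s | C s) \sum_(s' | agree t s s') g s s' =
  \sum_(s' | C s') \sum_(s | agree t s' s) g s s'.
Proof.
move=> CC; rewrite (exchange_big_dep C)/=; last by move=> s s' Cs /CC <-.
apply: eq_bigr => s' Cs'; apply: eq_bigl => s; rewrite agree_sym.
by case: (boolP (agree t s' s)) => [/CC <-|]; rewrite ?Cs' ?andbF.
Qed.

(** The inner sum is the conditional expectation of [a] given the path up to [t], and [C] is a union
    of atoms: this is the tower property. *)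
Lemma tail_weight_average t (C : pred path) (I a : path -> R) : (t <= n)%N ->
  (forall s s', agree t s s' -> C s = C s') ->
  (forall s s', agree t s s' -> I s = I s') ->
  \sum_(s | C s) I s * tail_weight t s *
     (\sum_(s' | agree t s s') tail_weight t s' * a s') =
  \sum_(s | C s) I s * tail_weight t s * a s.
Proof.
move=> tn CC II; under eq_bigr do rewrite mulr_sumr.
rewrite (agree_exchange _ CC); apply: eq_bigr => s' _.
transitivity (I s' * tail_weight t s' * a s' * \sum_(s | agree t s' s) tail_weight t s).
  rewrite mulr_sumr; apply: eq_bigr => s ss'; rewrite (II _ _ ss').
  by rewrite -!mulrA; congr (_ * _); rewrite mulrC -!mulrA.
by rewrite tail_weight_sum// mulr1.
Qed.

(** Sums over atoms are written as sums over paths, each term being divided by the size of its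
    class. *)
Definition class_card t s : R := \sum_(s' | agree t s s') 1.

Lemma class_card_gt0 t s : 0 < class_card t s.
Proof.
rewrite /class_card (bigD1 s) ?agree_refl//= ltr_pwDl// sumr_ge0//.
Qed.

Lemma class_cardE t s s' : agree t s s' -> class_card t s = class_card t s'.
Proof.
move=> ss'; apply: eq_bigl => s''; apply/idP/idP; apply: agree_trans => //.
by rewrite agree_sym.
Qed.

(** On an atom [I] is constant and the tail weights sum to one; the right side spreads this total
    evenly over the atom. This is how the future of the chain is summed out. *)
Lemma tail_weight_marginal t (C : pred path) (I : path -> R) : (t <= n)%N ->
  (forall s s', agree t s s' -> C s = C s') ->
  (forall s s', agree t s s' -> I s = I s') ->
  \sum_(s | C s) I s * tail_weight t s = \sum_(s | C s) I s / class_card t s.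
Proof.
move=> tn CC II.
transitivity (\sum_(s | C s) \sum_(s' | agree t s s')
    I s / class_card t s * tail_weight t s'); last first.
  by apply: eq_bigr => s _; rewrite -mulr_sumr tail_weight_sum// mulr1.
rewrite (agree_exchange _ CC); apply: eq_bigr => s _.
transitivity (\sum_(s' | agree t s s') I s / class_card t s * tail_weight t s * 1).
  rewrite -mulr_sumr -/(class_card t s) mulrAC divfK//.
  by rewrite gt_eqF// class_card_gt0.
by apply: eq_bigr => s' ss'; rewrite mulr1 (II _ _ ss') (class_cardE ss').
Qed.

End paths.

(** * Finite mixtures *)

Section mixture.
Context d (T : measurableType d) (R : realType) (P : probability T R).
Context (J : finType) d' (Z : measurableType d') (G : J -> T -> Z) (w : J -> T -> R).
Hypothesis mG : forall i, measurable_fun setT (G i).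
Hypothesis mw : forall i, measurable_fun setT (w i).
Hypothesis w0 : forall i x, 0 <= w i x.
Hypothesis w1 : forall x, \sum_i w i x = 1.

(** The law of [G i x] when [x] has law [P] and, given [x], the index [i] has probability [w i x].
    The coupling, the laws of both approximating processes and the transition laws of the chain all
    arise in this way. *)
Definition mixture (D : set Z) : \bar R :=
  (\sum_i \int[P]_(x in G i @^-1` D) (w i x)%:E)%E.

Let mGD i D : measurable D -> measurable (G i @^-1` D).
Proof. by move=> mD; rewrite -[X in measurable X]setTI; exact: mG. Qed.

Let mixture0 : mixture set0 = 0%E.
Proof.
by rewrite /mixture big1// => i _; rewrite preimage_set0 integral_set0.
Qed.

Let mixture_ge0 D : (0 <= mixture D)%E.
Proof.
by apply: sume_ge0 => i _; apply: integral_ge0 => x _; rewrite lee_fin.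
Qed.

Let mixture_additive : semi_sigma_additive mixture.
Proof.
move=> F mF tF mU.
have -> : mixture (\bigcup_k F k) = (\sum_(0 <= k <oo) mixture (F k))%E.
  rewrite /mixture nneseries_sum; last first.
    by move=> i k _; apply: integral_ge0 => x _; rewrite lee_fin.
  apply: eq_bigr => i _; rewrite preimage_bigcup.
  rewrite ge0_integral_bigcup//=.
  - by move=> k; exact: mGD.
  - by apply/measurable_funTS/measurable_EFinP.
  - by move=> x _; rewrite lee_fin.
  - apply/trivIsetP => a b _ _ ab; move/trivIsetP : tF => /(_ a b I I ab).
    by rewrite -preimage_setI => ->; rewrite preimage_set0.
exact: is_cvg_nneseries.
Qed.

HB.instance Definition _ :=
  isMeasure.Build _ _ _ mixture mixture0 mixture_ge0 mixture_additive.

Let mixture_setT : mixture setT = 1%E.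
Proof.
rewrite /mixture; under eq_bigr do rewrite preimage_setT.
rewrite -ge0_integral_sum//=.
- rewrite -[RHS](integral_cstT P); apply: eq_integral => x _.
  by rewrite sumEFin w1.
- by move=> i; apply/measurable_EFinP.
- by move=> i x _; rewrite lee_fin.
Qed.

HB.instance Definition _ := Measure_isProbability.Build _ _ _ mixture mixture_setT.

Lemma mixture_ex : exists Q : probability Z R, forall D,
  Q D = (\sum_i \int[P]_(x in G i @^-1` D) (w i x)%:E)%E.
Proof. by exists mixture. Qed.

Lemma mixture_fin (Q : probability Z R) D :
  (forall D, Q D = (\sum_i \int[P]_(x in G i @^-1` D) (w i x)%:E)%E) ->
  measurable D ->
  Q D = (\sum_i \int[P]_(x in G i @^-1` D) w i x)%:E.
Proof.
move=> QE mD; rewrite QE -sumEFin; apply: eq_bigr => i _.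
rewrite RintegralT_fin//; last exact: mGD.
apply: (@bounded_integrable _ _ _ _ _ 1) => // x.
by rewrite ger0_norm// -(w1 x) (bigD1 i)//= lerDl sumr_ge0.
Qed.

End mixture.

Section finite_support.
Context d (T : measurableType d) (R : realType) (P : probability T R).

(* No measurability of [f]: the integral of a nonnegative function is a supremum
   over the simple functions below it. *)
Lemma ge0_le_integral_nomeas (f g : T -> \bar R) :
  (forall x, 0 <= f x)%E -> (forall x, f x <= g x)%E ->
  (\int[P]_x f x <= \int[P]_x g x)%E.
Proof.
move=> f0 fg; rewrite !ge0_integralTE//; last first.
  by move=> x; exact: le_trans (fg x).
apply: ub_ereal_sup => _ [h hf <-]; apply: ereal_sup_ubound.
by exists h => // x; exact: le_trans (fg x).
Qed.

(** [f] is dominated by [g] on [D] and by infinity elsewhere, and changing the bound on a null set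
    does not change its integral. Measurability is asked of the bound only, which spares the joint
    measurability of the distance between two processes. *)
Lemma integral_le_ae_bound (D : set T) (f g : T -> \bar R) :
  measurable D -> P D = 1%E -> measurable_fun setT g ->
  (forall x, 0 <= f x)%E -> (forall x, 0 <= g x)%E ->
  (forall x, D x -> f x <= g x)%E ->
  (\int[P]_x f x <= \int[P]_x g x)%E.
Proof.
move=> mD PD mg f0 g0 fg.
pose h x := if x \in D then g x else +oo%E.
apply: (@le_trans _ _ (\int[P]_x h x)%E).
  apply: ge0_le_integral_nomeas => // x; rewrite /h; case: ifPn => [|_].
    by rewrite inE => /fg.
  exact: leey.
rewrite le_eqVlt; apply/orP; left; apply/eqP.
have mh : measurable_fun setT h.
  apply: measurable_fun_ifT => //.
  by apply: (measurable_fun_bool true); rewrite setTI preimage_mem_true.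
apply: ae_eq_integral => //.
exists (~` D); split; first exact: measurableC.
  by have := probability_setC P mD; rewrite PD subee.
by move=> x /= xh Dx; apply: xh => _; rewrite /h mem_set.
Qed.

End finite_support.

(** * The coupling of a process with a Markov chain *)

Section coupling_weights.
Context d (T : measurableType d) (R : realType) (P : probability T R).
Context (n M : nat) (F : nat -> set (set T)).
Hypothesis sF : forall u, sigma_algebra setT (F u).
Hypothesis mF : forall u, F u `<=` measurable.
Hypothesis monoF : forall u v, (u <= v)%N -> F u `<=` F v.

Local Notation state := 'I_M.+1.
Local Notation path := {ffun 'I_n.+1 -> 'I_M.+1}.
Local Notation L1 f := (P.-integrable [set: T] (EFin \o f)).

Context (q : nat -> T -> state) (k : nat -> state -> state -> R).
Context (a : nat -> state -> T -> R) (dl : R).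
Hypothesis mq : forall u j, F u (q u @^-1` [set j]).
Hypothesis k0 : forall u i j, 0 <= k u i j.
Hypothesis k1 : forall u i, (u < n)%N -> \sum_j k u i j = 1.
Hypothesis ma : forall u j, (u < n)%N -> sub_measurable (F u) (a u j).
Hypothesis a0 : forall u j x, (u < n)%N -> 0 <= a u j x.
Hypothesis a1 : forall u x, (u < n)%N -> \sum_j a u j x = 1.
Hypothesis aP : forall u j C, (u < n)%N -> F u C ->
  \int[P]_(x in C) a u j x = fine (P (q u.+1 @^-1` [set j] `&` C)).
Hypothesis dl01 : 0 <= dl <= 1.
Hypothesis ka : forall u x j, (u < n)%N -> (1 - dl) * a u j x <= k u (q u x) j.

(* The conditional law of the next state of the chain: it keeps the transition
   kernel [k] given [F u], but follows [q] with probability at least [1 - dl]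
   as long as it has done so. *)
Definition move u x i j : R :=
  k u i j + (1 - dl) * (q u x == i)%:R * ((q u.+1 x == j)%:R - a u j x).

Lemma sum_delta (i : state) : \sum_j (i == j)%:R = 1 :> R.
Proof.
rewrite (bigD1 i)//= eqxx big1 ?addr0// => j /negbTE.
by rewrite eq_sym => ->.
Qed.

Lemma move_sum u x i : (u < n)%N -> \sum_j move u x i j = 1.
Proof.
move=> un; rewrite big_split/= k1// -mulr_sumr sumrB sum_delta a1//.
by rewrite subrr mulr0 addr0.
Qed.

(** Here the domination [ka] enters: the part [(1 - dl) * a u j x] taken away never exceeds [k]. Off
    [i = q u x] the move is the kernel itself. *)
Lemma move_ge0 u x i j : (u < n)%N -> 0 <= move u x i j.
Proof.
move=> un; rewrite /move; case: eqVneq => [<-|_]; last first.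
  by rewrite mulr0 mul0r addr0.
have /andP[d0 d1] := dl01.
rewrite mulr1 mulrBr addrCA addr_ge0//; last by rewrite subr_ge0 ka.
by rewrite mulr_ge0// subr_ge0.
Qed.

Lemma move_follow u x : (u < n)%N -> 1 - dl <= move u x (q u x) (q u.+1 x).
Proof.
move=> un; rewrite /move !eqxx mulr1 mulrBr mulr1 addrCA lerDl subr_ge0.
exact: ka.
Qed.

Lemma move_le1 u x i j : (u < n)%N -> move u x i j <= 1.
Proof.
move=> un; rewrite -(move_sum x i un) (bigD1 j)//= lerDl sumr_ge0// => *.
exact: move_ge0.
Qed.

Lemma sub_measurableS u v (f : T -> R) : (u <= v)%N ->
  sub_measurable (F u) f -> sub_measurable (F v) f.
Proof. by move=> uv mf B mB; apply: monoF uv _ _; exact: mf. Qed.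

Lemma sub_measurable_state u (i : state) :
  sub_measurable (F u) (fun x => (q u x == i)%:R : R).
Proof.
rewrite (_ : (fun _ => _) = \1_(q u @^-1` [set i]) :> (T -> R)).
  exact: sub_measurable_indic.
apply/funext => x; rewrite indicE; suff -> : (q u x == i) = (x \in q u @^-1` [set i]) by [].
by apply/eqP/idP; rewrite inE.
Qed.

Lemma sub_measurable_move u i j : (u < n)%N ->
  sub_measurable (F u.+1) (fun x => move u x i j).
Proof.
move=> un; rewrite /move.
apply: sub_measurableD => //; first exact: sub_measurable_cst.
apply: sub_measurableM => //.
  apply: sub_measurableM => //; first exact: sub_measurable_cst.
  by apply: (sub_measurableS (leqnSn u)); exact: sub_measurable_state.
apply: sub_measurableB => //; first exact: sub_measurable_state.
by apply: (sub_measurableS (leqnSn u)); exact: ma.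
Qed.

(** The conditional probability, given the process, that the chain runs through [s] up to time
    [t]. *)
Definition weight t x (s : path) : R :=
  (q 0 x == s (inord 0))%:R *
  \prod_(0 <= u < t) move u x (s (inord u)) (s (inord u.+1)).

Lemma weightS t x s :
  weight t.+1 x s = weight t x s * move t x (s (inord t)) (s (inord t.+1)).
Proof. by rewrite /weight big_nat_recr//= mulrA. Qed.

Lemma weight_bounds t x s : (t <= n)%N -> 0 <= weight t x s <= 1.
Proof.
elim: t => [_|t ih tn].
  by rewrite /weight big_geq// mulr1; case: (_ == _); rewrite ?ler01 ?lexx.
have /andP[w0 w1] := ih (ltnW tn).
rewrite weightS mulr_ge0 ?move_ge0//=.
by rewrite mulr_ile1// ?move_ge0// move_le1.
Qed.

Lemma weight_tail t x s : (t <= n)%N ->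
  weight n x s = weight t x s * tail_weight (fun u => move u x) t s.
Proof. by move=> tn; rewrite /weight /tail_weight -mulrA -big_cat_nat. Qed.

Lemma weight_agree t x s s' : (t <= n)%N -> agree t s s' ->
  weight t x s = weight t x s'.
Proof.
move=> tn ss'; rewrite /weight (agree_inord tn (leq0n t) ss'); congr (_ * _).
apply: eq_big_nat => u /andP[_ ut].
by rewrite (agree_inord tn (ltnW ut) ss') (agree_inord tn ut ss').
Qed.

Lemma sub_measurable_weight t s : (t <= n)%N ->
  sub_measurable (F t) (fun x => weight t x s).
Proof.
elim: t => [_|t ih tn].
  rewrite (_ : (fun _ => _) = fun x => (q 0 x == s (inord 0))%:R).
    exact: sub_measurable_state.
  by apply/funext => x; rewrite /weight big_geq// mulr1.
rewrite (_ : (fun _ => _) = fun x => weight t x s * move t x (s (inord t)) (s (inord t.+1))).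
  apply: sub_measurableM => //; last exact: sub_measurable_move.
  by apply: (sub_measurableS (leqnSn t)); apply/ih/ltnW.
by apply/funext => x; rewrite weightS.
Qed.

Lemma measurable_weight t s : (t <= n)%N ->
  measurable_fun setT (fun x => weight t x s).
Proof. by move=> tn; apply: sub_measurableW (sub_measurable_weight s tn). Qed.

Lemma weight_sum x : \sum_s weight n x s = 1.
Proof.
rewrite -(@tail_weight_sum R n M (fun u => move u x) _ 0 [ffun=> q 0 x])//; last first.
  by move=> t i; exact: move_sum.
rewrite [RHS]big_mkcond/=; apply: eq_bigr => s _.
rewrite (@weight_tail 0)// /weight big_geq// mulr1.
have -> : agree 0 [ffun=> q 0 x] s = (q 0 x == s (inord 0)).
  apply/agreeP/eqP => [h|h v].
    by rewrite -(h (inord 0)) ?ffunE// inordK.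
  rewrite leqn0 ffunE h => /eqP v0; congr (s _); apply/val_inj => /=.
  by rewrite inordK.
by case: eqP => _; rewrite ?mul1r ?mul0r.
Qed.

(** Each step stays on [q] with probability at least [1 - dl]; the induction carries along the
    inequality (1 - dl)^t >= 1 - t dl. *)
Lemma weight_follow x : 1 - n%:R * dl <= weight n x [ffun v : 'I_n.+1 => q v x].
Proof.
have /andP[d0 d1] := dl01.
pose sx : path := [ffun v : 'I_n.+1 => q v x].
have sxE u : (u <= n)%N -> sx (inord u) = q u x by move=> un; rewrite ffunE inordK.
suff H t : (t <= n)%N -> 1 - t%:R * dl <= weight t x sx by exact: H.
elim: t => [_|t ih tn].
  by rewrite /weight big_geq// sxE// eqxx mul0r subr0 mulr1.
have /andP[w0 w1] := weight_bounds x sx (ltnW tn).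
have m1 := move_le1 x (q t x) (q t.+1 x) tn.
have mf := move_follow x tn.
have {}ih := ih (ltnW tn).
rewrite weightS !sxE//; last exact: ltnW.
rewrite -natr1; nra.
Qed.

Let intw t s : (t <= n)%N -> L1 (fun x => weight t x s).
Proof.
move=> tn; apply: (@bounded_integrable _ _ _ _ _ 1); first exact: measurable_weight.
by move=> x; have /andP[w0 w1] := weight_bounds x s tn; rewrite ger0_norm.
Qed.

(** [move] differs from [k] by a factor known at time [t] times [f], the indicator of the next state
    minus its conditional probability. So [f] integrates to zero over sets of [F t], and still does
    against the bounded factor [b]. *)
Lemma Rintegral_weightS t s C : (t < n)%N -> F t C ->
  \int[P]_(x in C) weight t.+1 x s =
  k t (s (inord t)) (s (inord t.+1)) * \int[P]_(x in C) weight t x s.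
Proof.
move=> tn FC; have mC := mF FC; have tn' := ltnW tn.
set i := s (inord t); set j := s (inord t.+1).
have /andP[d0 d1] := dl01.
pose f x : R := (q t.+1 x == j)%:R - a t j x.
pose b x : R := weight t x s * (q t x == i)%:R.
have mst u (l : state) : measurable_fun setT (fun x => (q u x == l)%:R : R).
  exact: sub_measurableW (sub_measurable_state u l).
have intst u (l : state) : L1 (fun x => (q u x == l)%:R).
  apply: (@bounded_integrable _ _ _ _ _ 1) => // x.
  by case: (_ == _); rewrite ?normr1 ?normr0.
have inta : L1 (a t j).
  apply: (@bounded_integrable _ _ _ _ _ 1) => [|x].
    by apply: sub_measurableW (ma j tn).
  by rewrite ger0_norm ?a0// -(a1 x tn) (bigD1 j)//= lerDl sumr_ge0// => *; rewrite a0.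
have intf : L1 f by exact: integrable_subR.
have b01 x : 0 <= b x <= 1.
  rewrite /b; have /andP[w0 w1] := weight_bounds x s tn'.
  by case: (_ == _); rewrite ?mulr1 ?mulr0 ?w0 ?w1 ?lexx ?ler01.
have mb : sub_measurable (F t) b.
  apply: sub_measurableM => //; first exact: sub_measurable_weight.
  exact: sub_measurable_state.
have intfb : L1 (fun x => f x * b x).
  apply: (@integrable_mul_bounded _ _ _ _ _ _ 1) => //.
    exact: sub_measurableW mb.
  by move=> x; have /andP[? ?] := b01 x; rewrite ger0_norm.
transitivity (\int[P]_(x in C) (k t i j * weight t x s + (1 - dl) * (f x * b x))).
  apply: eq_Rintegral => x _; rewrite weightS /move -/i -/j /f /b; ring.
rewrite RintegralD//; [|exact/integrable_onR/integrable_scaleR/intw|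
  exact/integrable_onR/integrable_scaleR].
rewrite !RintegralZl//; [|exact/integrable_onR|exact/integrable_onR/intw].
rewrite (bounded_pullout (sF t) (@mF t))// ?mulr0 ?addr0// => D FD.
have mD := mF FD.
rewrite RintegralB//; [|exact: integrable_onR..].
rewrite aP//; apply/eqP; rewrite subr_eq0; apply/eqP.
rewrite -Rintegral_indic//; last exact: mF (mq t.+1 j).
apply: eq_Rintegral => x _; rewrite indicE.
suff -> : (q t.+1 x == j) = (x \in q t.+1 @^-1` [set j]) by [].
by apply/eqP/idP; rewrite inE.
Qed.

(** Given [F t] and its own past, the chain goes on with the deterministic kernel [k], as if it had
    learnt nothing about the process except through its state. Anticausality rests on this. *)
Lemma Rintegral_weight_tail t s C : (t <= n)%N -> F t C ->
  \int[P]_(x in C) weight n x s =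
  \int[P]_(x in C) weight t x s * tail_weight k t s.
Proof.
move=> tn FC; rewrite /tail_weight.
suff H v : (t <= v <= n)%N -> \int[P]_(x in C) weight v x s =
    \int[P]_(x in C) weight t x s *
    \prod_(t <= u < v) k u (s (inord u)) (s (inord u.+1)).
  by apply: H; rewrite tn leqnn.
elim: v => [|v ih] /andP[tv vn].
  by move: tv; rewrite leqn0 => /eqP ->; rewrite big_geq// mulr1.
move: tv; rewrite leq_eqVlt => /orP[/eqP <-|tv]; first by rewrite big_geq// mulr1.
rewrite ltnS in tv.
rewrite (Rintegral_weightS s vn (monoF tv FC)).
by rewrite ih ?tv ?(ltnW vn)// big_nat_recr//= mulrCA [k v _ _ * _]mulrC.
Qed.

End coupling_weights.

(** * Bicausality of the coupling of a process with the chain *)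

Section bicausal.
Context (R : realType) (n : nat) (X : 'I_n.+1 -> polishMetricType R).
Variable x : filtered_process X.

(* The filtration indexed by all of nat, constant from time [n] on. *)
Definition filt_nat (u : nat) : set (set (fp_space x)) := fp_filt (inord (minn u n)).

Lemma filt_nat_sigma u : sigma_algebra setT (filt_nat u).
Proof. exact: fp_filt_sigma. Qed.

Lemma filt_nat_measurable u : filt_nat u `<=` measurable.
Proof. exact: fp_filt_measurable. Qed.

Lemma filt_nat_mono u v : (u <= v)%N -> filt_nat u `<=` filt_nat v.
Proof.
move=> uv; apply: fp_filt_mono.
by rewrite !inordK ?ltnS ?geq_minr// leq_min geq_minr andbT geq_min uv.
Qed.

Lemma filt_natE (t : 'I_n.+1) : filt_nat t = fp_filt t.
Proof.
have tE : minn t n = t by apply/minn_idPl; rewrite -ltnS.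
by rewrite /filt_nat tE inord_val.
Qed.

Variable M : nat.
Local Notation state := 'I_M.+1.
Local Notation path := {ffun 'I_n.+1 -> 'I_M.+1}.
Local Notation T := (fp_space x).
Local Notation P := (fp_prob x).
Local Notation F := filt_nat.

Context (q : nat -> T -> state) (k : nat -> state -> state -> R).
Context (a : nat -> state -> T -> R) (dl : R).
Hypothesis mq : forall u j, F u (q u @^-1` [set j]).
Hypothesis k0 : forall u i j, 0 <= k u i j.
Hypothesis k1 : forall u i, (u < n)%N -> \sum_j k u i j = 1.
Hypothesis ma : forall u j, (u < n)%N -> sub_measurable (F u) (a u j).
Hypothesis a0 : forall u j w, (u < n)%N -> 0 <= a u j w.
Hypothesis a1 : forall u w, (u < n)%N -> \sum_j a u j w = 1.
Hypothesis aP : forall u j C, (u < n)%N -> F u C ->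
  \int[P]_(w in C) a u j w = fine (P (q u.+1 @^-1` [set j] `&` C)).
Hypothesis dl01 : 0 <= dl <= 1.
Hypothesis ka : forall u w j, (u < n)%N -> (1 - dl) * a u j w <= k u (q u w) j.

Local Notation W := (fun t (s : path) w => weight q k a dl t w s).

(* [y] is only known through a map [emb] of the chain into it, so that one
   coupling serves the finite process and the plain one. *)
Variable y : filtered_process X.
Variable emb : path -> fp_space y.
Hypothesis yP : forall D, fp_prob y D =
  (\sum_s \int[P]_(w in (fun=> emb s) @^-1` D) (W n s w)%:E)%E.
(** On the image of [emb], this and [yC] make the filtration of [y] that of the chain: [yF] keeps
    [fp_filt t] from looking beyond time [t], [yC] lets it see the whole past. *)
Hypothesis yF : forall t A, fp_filt t A ->
  forall s s', agree t s s' -> (emb s \in A) = (emb s' \in A).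
Hypothesis yC : forall (t : 'I_n.+1) s, exists2 A, fp_filt t A &
  forall s', (emb s' \in A) = agree t s s'.

Local Notation Z := (T * fp_space y)%type.

Variable pi : probability Z R.
Hypothesis piE : forall D, pi D =
  (\sum_s \int[P]_(w in (fun w => (w, emb s)) @^-1` D) (W n s w)%:E)%E.

Let mT A t : fp_filt t A -> measurable (A : set T).
Proof. exact: fp_filt_measurable. Qed.

Let mY A t : fp_filt t A -> measurable (A : set (fp_space y)).
Proof. exact: fp_filt_measurable. Qed.

Let W_bounds t s w : (t <= n)%N -> 0 <= W t s w <= 1.
Proof. by move=> tn; apply: weight_bounds. Qed.

Let mW t s : (t <= n)%N -> measurable_fun setT (W t s).
Proof.
move=> tn; apply: (measurable_weight filt_nat_sigma filt_nat_measurable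
  filt_nat_mono) => //.
Qed.

Let intW t s : (t <= n)%N -> P.-integrable setT (EFin \o W t s).
Proof.
move=> tn; apply: (@bounded_integrable _ _ _ _ _ 1); first exact: mW.
by move=> w; have /andP[w0 w1] := W_bounds s w tn; rewrite ger0_norm.
Qed.

Let W_sum w : \sum_s W n s w = 1.
Proof. by apply: weight_sum. Qed.

Let piR A B : measurable A -> measurable B ->
  fine (pi (fst @^-1` A `&` snd @^-1` B)) =
  \sum_(s | emb s \in B) \int[P]_(w in A) W n s w.
Proof.
move=> mA mB.
have mAB : measurable (fst @^-1` A `&` snd @^-1` B : set Z).
  apply: measurableI; rewrite -[X in measurable X]setTI.
    exact: measurable_fst.
  exact: measurable_snd.
rewrite (mixture_fin _ _ _ _ piE)//=.
- rewrite [RHS]big_mkcond/=; apply: eq_bigr => s _.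
  case: ifPn => [|] sB.
    congr (Rintegral _ _ _); apply/seteqP; split => [w []//|w wA].
    by split=> //; rewrite inE in sB.
  rewrite -(Rintegral_set0 P (W n s)); congr (Rintegral _ _ _).
  apply/seteqP; split => w //= [_ /=].
  by move=> h; move: sB; rewrite notin_setE.
- by move=> s; exact: mW.
- by move=> s w; have /andP[] := W_bounds s w (leqnn n).
Qed.

Lemma mixture_coupling : coupling pi.
Proof.
split=> [A mA|B mB]; last by rewrite piE yP.
have mfA : measurable (fst @^-1` A : set Z).
  by rewrite -[X in measurable X]setTI; exact: measurable_fst.
have := piR mA measurableT.
rewrite preimage_setT setIT (eq_bigl xpredT); last by move=> s; rewrite in_setT.
rewrite -Rintegral_sum//; last by move=> s _; exact: intW.
under eq_Rintegral do rewrite W_sum.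
rewrite Rintegral_cst// mul1r => piA.
by rewrite -[LHS]fineK ?fin_num_measure// piA fineK// fin_num_measure.
Qed.

Let lift1_sigma t : sigma_algebra setT (@lift_filt1 _ _ _ x y t : set (set Z)).
Proof. exact/sigma_algebra_preimage/fp_filt_sigma. Qed.

Let lift2_sigma t : sigma_algebra setT (@lift_filt2 _ _ _ x y t).
Proof. exact/sigma_algebra_preimage/fp_filt_sigma. Qed.

Let lift1_measurable t : @lift_filt1 _ _ _ x y t `<=` (measurable : set (set Z)).
Proof. by move=> _ [A FA <-]; apply: measurable_fst => //; exact: mT FA. Qed.

Let lift2_measurable t : @lift_filt2 _ _ _ x y t `<=` measurable.
Proof. by move=> _ [A FA <-]; apply: measurable_snd => //; exact: mY FA. Qed.

Lemma Rintegral_fst A (f : T -> R) : measurable A -> measurable_fun setT f ->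
  P.-integrable setT (EFin \o f) ->
  \int[pi]_(z in fst @^-1` A) f z.1 = \int[P]_(w in A) f w.
Proof.
move=> mA mf intf; congr fine.
have [pi1 _] := mixture_coupling.
have mfA : measurable (fst @^-1` A : set Z).
  by rewrite -[X in measurable X]setTI; exact: measurable_fst.
have pushE (D : set T) (g : T -> \bar R) : measurable D ->
    (\int[P]_(w in D) g w = \int[pushforward pi fst]_(w in D) g w)%E.
  by move=> mD; apply: eq_measure_integral => E mE _; exact: esym (pi1 E mE).
rewrite pushE//; symmetry.
apply: (integral_pushforward measurable_fst (f := EFin \o f)) => //.
  exact/measurable_EFinP.
apply: (integrableS measurableT) => //.
apply/integrableP; split.
  by apply/measurable_EFinP; apply: measurableT_comp.
move/integrableP : intf => [_]; rewrite pushE//.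
rewrite ge0_integral_pushforward//.
by apply/measurableT_comp => //; exact/measurable_EFinP.
Qed.

Lemma mixture_causal : causal pi.
Proof.
move=> t.
(* The set to be predicted is an event of the chain at time [t]; causality is the second conclusion
   of the criterion, with the two roles exchanged. *)
apply: (@cond_indep_crit _ _ _ pi (@lift_filt2 _ _ _ x y t) _ _ _ _ _ _ _ _).2 => //.
  exists setT; last by rewrite preimage_setT setIT.
  exact: (@sub_setT _ (fp_space x) _ (@fp_filt_sigma _ _ _ x ord_max)).
move=> _ [A FA <-].
have tn : (t <= n)%N by rewrite -ltnS.
pose C : pred path := fun s => emb s \in A.
have Cagree s s' : agree t s s' -> C s = C s' by exact: yF.
(* Summing out the times after [t] makes the conditional probability of [C]
   given the whole process measurable at time [t]. *)
pose phi (w : T) : R := \sum_(s | C s) W t s w / class_card R t s.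
have phiE w : phi w = \sum_(s | C s) W n s w.
  rewrite /phi -(@tail_weight_marginal _ _ _ (fun u => move q k a dl u w))//.
  - by apply: eq_bigr => s _; rewrite -weight_tail.
  - by move=> u i un; exact: (move_sum q dl k1 a1 w i un).
  - by move=> s s' ss'; exact: weight_agree.
have phi01 w : 0 <= phi w <= 1.
  have W0 s : 0 <= W n s w by have /andP[] := W_bounds s w (leqnn n).
  rewrite phiE sumr_ge0//= -(W_sum w) [leRHS](bigID C)/= lerDl.
  by rewrite sumr_ge0.
have mphi : sub_measurable (F t) phi.
  apply: sub_measurable_sum => [|s _]; first exact: filt_nat_sigma.
  apply: sub_measurableM; [exact: filt_nat_sigma| |].
    by apply: (sub_measurable_weight filt_nat_sigma filt_nat_mono).
  exact: sub_measurable_cst (filt_nat_sigma t) _.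
have mphiT := sub_measurableW (@filt_nat_measurable t) mphi.
exists 1, (phi \o fst); split=> [B mB|z|B1 D1].
- by exists (phi @^-1` B); [rewrite -filt_natE; exact: mphi|rewrite setTI].
- exact: phi01.
move=> [B FB <-] [D FD <-]; rewrite !setTI.
have mBD : measurable (D `&` B) by apply: measurableI; [exact: mT FD|exact: mT FB].
rewrite -preimage_setI Rintegral_fst//; last first.
  apply: (@bounded_integrable _ _ _ _ _ 1) => // w.
  by have /andP[? ?] := phi01 w; rewrite ger0_norm.
under eq_Rintegral do rewrite phiE.
rewrite Rintegral_sum//; last by move=> s _; exact: intW.
rewrite -piR//; last exact: mY FA.
by rewrite preimage_setI setIC [_ `&` fst @^-1` B]setIC setIA.
Qed.

Lemma mixture_anticausal : anticausal pi.
Proof.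
move=> t.
apply: (@cond_indep_crit _ _ _ pi (@lift_filt2 _ _ _ x y ord_max) _ _ _ _ _ _ _ _).1 => //.
  exists setT; last by rewrite preimage_setT setIT.
  exact: (@sub_setT _ (fp_space x) _ (@fp_filt_sigma _ _ _ x t)).
move=> _ [A FA <-].
have tn : (t <= n)%N by rewrite -ltnS.
have mA := mY FA.
have [Cs FCs CsE] : exists2 Cs : path -> set (fp_space y),
    forall s, fp_filt t (Cs s) & forall s s', (emb s' \in Cs s) = agree t s s'.
  have h s := cid2 (yC t s).
  by exists (fun s => s2val (h s)) => s; [exact: (s2valP (h s))|exact: (s2valP' (h s))].
(* [kap s] is the probability of [A] under the kernel [k], given the path up to [t]; [phi] is the
   corresponding function on [y], measurable at time [t]. An atom occurs once for each of its paths,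
   hence the division by [class_card]. *)
pose kap s : R := \sum_(s' | agree t s s') tail_weight k t s' * (emb s' \in A)%:R.
have kap0 s : 0 <= kap s.
  apply: sumr_ge0 => s' _; rewrite mulr_ge0//.
  by apply: prodr_ge0 => u _.
have kapE s s' : agree t s s' -> kap s = kap s'.
  move=> ss'; apply: eq_bigl => s''; apply/idP/idP; apply: agree_trans => //.
  by rewrite agree_sym.
pose r s := kap s / class_card R t s.
have r0 s : 0 <= r s by rewrite divr_ge0// ltW// class_card_gt0.
pose phi (z : fp_space y) : R := \sum_s r s * \1_(Cs s) z.
have phi_bounds z : 0 <= phi z <= \sum_s r s.
  rewrite sumr_ge0/=; last by move=> s _; rewrite mulr_ge0// indicE.
  by apply: ler_sum => s _; rewrite indicE ler_piMr// lern1 leq_b1.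
have mphi : sub_measurable (fp_filt t) phi.
  apply: sub_measurable_sum => [|s _]; first exact: fp_filt_sigma.
  apply: sub_measurableM; [exact: fp_filt_sigma| |].
    exact: (@sub_measurable_cst _ (fp_space y) _ _ (@fp_filt_sigma _ _ _ y t)).
  exact: (@sub_measurable_indic _ (fp_space y) _ _ (@fp_filt_sigma _ _ _ y t)).
exists (\sum_s r s), (phi \o snd); split=> [B mB|z|B1 D1].
- by exists (phi @^-1` B); [exact: mphi|rewrite setTI].
- exact: phi_bounds.
move=> [B FB <-] [D FD <-]; rewrite !setTI.
have mB := mT FB; have mD := mY FD.
have mf (E : set T) : measurable E -> measurable (fst @^-1` E : set Z).
  by move=> mE; rewrite -[X in measurable X]setTI; exact: measurable_fst.
have ms (E : set (fp_space y)) : measurable E -> measurable (snd @^-1` E : set Z).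
  by move=> mE; rewrite -[X in measurable X]setTI; exact: measurable_snd.
have mBD : measurable (snd @^-1` D `&` fst @^-1` B : set Z).
  by apply: measurableI; [exact: ms|exact: mf].
have mCs s : measurable (Cs s) := mY (FCs s).
have int1 s : pi.-integrable setT (EFin \o (\1_(snd @^-1` Cs s) : Z -> R)).
  by apply: integrable_indic; exact: ms.
pose J s := \int[P]_(w in B) W n s w.
(* Both sides become sums over paths: the left one is an average of [kap] over the law of the chain
   on [B], and the tower property replaces [kap] by the indicator of [A]. *)
transitivity (\sum_s \sum_(s' | agree t s s') (emb s' \in D)%:R * r s * J s').
  transitivity (\int[pi]_(z in snd @^-1` D `&` fst @^-1` B)
      \sum_s r s * \1_(snd @^-1` Cs s) z); first by [].
  rewrite Rintegral_sum//; last by move=> s _; exact: integrable_scaleR.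
  apply: eq_bigr => s _; rewrite RintegralZl//; last exact: integrable_onR.
  rewrite Rintegral_indic//; last exact: ms.
  rewrite setIA [_ `&` fst @^-1` B]setIC -preimage_setI piR//; last exact: measurableI.
  rewrite mulr_sumr big_mkcond [RHS]big_mkcond; apply: eq_bigr => s' _.
  rewrite in_setI CsE; case: (agree t s s') => //=.
  by case: (_ \in D); rewrite /= ?mul1r ?mul0r.
rewrite (agree_exchange _ (C := xpredT))//=.
have FB' : F t B by rewrite filt_natE.
pose I0 s := \int[P]_(w in B) W t s w.
have JE s : J s = I0 s * tail_weight k t s.
  by apply: (Rintegral_weight_tail filt_nat_sigma filt_nat_measurable filt_nat_mono).
have I0E s s' : agree t s s' -> I0 s = I0 s'.
  by move=> ss'; apply: eq_Rintegral => w _; exact: weight_agree.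
transitivity (\sum_(s | emb s \in D) I0 s * tail_weight k t s * kap s).
  rewrite [RHS]big_mkcond/=; apply: eq_bigr => s _.
  transitivity ((emb s \in D)%:R * J s * r s * class_card R t s).
    rewrite /class_card mulr_sumr; apply: eq_bigr => s' ss'.
    by rewrite /r (kapE _ _ ss') (class_cardE _ ss') mulr1 mulrAC.
  rewrite /r -mulrA divfK ?gt_eqF ?class_card_gt0// -JE.
  by case: (emb s \in D); rewrite ?mul1r ?mul0r.
rewrite tail_weight_average//; last by move=> s s'; exact: yF.
transitivity (\sum_(s | emb s \in (A `&` D)) J s).
  rewrite big_mkcond [RHS]big_mkcond; apply: eq_bigr => s _.
  rewrite in_setI JE; case: (emb s \in D); rewrite ?andbF//= andbT.
  by case: (emb s \in A); rewrite ?mulr1 ?mulr0.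
rewrite -piR//; last exact: measurableI.
by rewrite preimage_setI setICA setIA.
Qed.

Lemma mixture_bicausal : bicausal_coupling pi.
Proof.
split; [exact: mixture_coupling|exact: mixture_causal|exact: mixture_anticausal].
Qed.

(** * Cost of the coupling *)

Section cost.
Context (p : R) (val f : forall t : 'I_n.+1, state -> X t).
Hypothesis p1 : 1 <= p.
Hypothesis procE : forall t s, fp_proc t (emb s) = f t (s t).
Hypothesis memb : forall s, measurable [set emb s].

Definition quantization_cost (w : T) : R :=
  \sum_(t < n.+1) mdist (fp_proc t w) (val t (q t w)) `^ p.

Context (eta kap D : R).
Hypothesis mcost : measurable_fun setT quantization_cost.
Hypothesis cost_le : (\int[P]_w (quantization_cost w)%:E <= eta%:E)%E.
(** [near] applies while the chain is in the state of [q], [far] once it may have left it. *)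
Hypothesis near : forall t i, mdist (val t i) (f t i) `^ p <= kap.
Hypothesis far : forall t i j, mdist (val t i) (f t j) `^ p <= D.

Let path_of (w : T) : path := [ffun v : 'I_n.+1 => q v w].

Let fiber s : set T := path_of @^-1` [set s].

Let mfiber s : measurable (fiber s).
Proof.
rewrite (_ : fiber s = \bigcap_(t : 'I_n.+1) (q t @^-1` [set s t])).
  apply: (@sub_bigcap_fin _ T _ (@sigma_algebra_measurable _ T)) => t.
  exact: filt_nat_measurable (mq _ _).
apply/seteqP; split => [w /= <- t _|w wE]; first by rewrite /= ffunE.
by apply/ffunP => t; rewrite ffunE; exact: wE.
Qed.

(** The event that the chain has followed [q] all along. *)
Let good : set Z := \bigcup_(s : path) (fiber s `*` [set emb s]).

Let mgood : measurable good.
Proof.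
apply: (@sub_bigcup_fin _ Z _ (@sigma_algebra_measurable _ Z)) => s.
exact: measurableX.
Qed.

(** For each [w] only the path [path_of w] is kept in the sum over [s], and its weight is bounded
    below by [weight_follow]. *)
Lemma follow_prob : ((1 - n%:R * dl)%:E <= pi good)%E.
Proof.
rewrite piE.
apply: (@le_trans _ _ (\sum_s \int[P]_(w in fiber s) (W n s w)%:E)%E); last first.
  apply: lee_sum => s _; apply: ge0_subset_integral => //.
  - rewrite -[X in measurable X]setTI; exact: pair2_measurable.
  - by apply/measurable_funTS/measurable_EFinP/mW.
  - by move=> w _; rewrite lee_fin; have /andP[] := W_bounds s w (leqnn n).
  - by move=> w ws; exists s.
under eq_bigr do rewrite integral_mkcond.
rewrite -ge0_integral_sum//; last 2 first.
- move=> s; apply/(measurable_restrictT _ _).1 => //.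
  by apply/measurable_funTS/measurable_EFinP/mW.
- move=> s w _; apply: erestrict_ge0 => {}w _.
  by rewrite lee_fin; have /andP[] := W_bounds s w (leqnn n).
rewrite -[leLHS]mule1 -(@probability_setT _ _ _ P) -integral_cst//.
rewrite [leRHS](eq_integral (fun w => (W n (path_of w) w)%:E)); last first.
  move=> w _; rewrite (bigD1 (path_of w))//= patchE mem_set//.
  rewrite big1 ?adde0// => s sw; rewrite patchE memNset// => /= ws.
  by move: sw; rewrite -ws eqxx.
have mWp : measurable_fun setT (fun w => W n (path_of w) w).
  rewrite (_ : (fun _ => _) = fun w => \sum_s W n s w * \1_(fiber s) w).
    apply: measurable_sum => s; apply: measurable_funM; [exact: mW|].
    exact: measurable_indic.
  apply/funext => w; rewrite (bigD1 (path_of w))//= indicE mem_set// mulr1.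
  rewrite big1 ?addr0// => s sw; rewrite indicE memNset ?mulr0// => /= ws.
  by move: sw; rewrite -ws eqxx.
have follow w : 1 - n%:R * dl <= W n (path_of w) w by exact: weight_follow.
have intWp : P.-integrable setT (EFin \o (fun w => W n (path_of w) w)).
  apply: (@bounded_integrable _ _ _ _ _ 1) => // w.
  by have /andP[? ?] := W_bounds (path_of w) w (leqnn n); rewrite ger0_norm.
apply: le_integral => //.
  exact: finite_measure_integrable_cst.
by move=> w _; rewrite lee_fin.
Qed.

(** The sum is at most twice the larger term, whose power is at most the sum of the powers. *)
Lemma powR_add_le (u v : R) : 0 <= u -> 0 <= v ->
  (u + v) `^ p <= 2 `^ p * (u `^ p + v `^ p).
Proof.
move=> u0 v0; have p0 : 0 <= p by apply: le_trans p1.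
have [uv|vu] := leP u v.
  apply: (@le_trans _ _ ((2 * v) `^ p)).
    by rewrite ge0_ler_powR ?nnegrE ?addr_ge0 ?mulr_ge0//; lra.
  by rewrite powRM// ler_wpM2l ?powR_ge0// lerDr powR_ge0.
apply: (@le_trans _ _ ((2 * u) `^ p)).
  by rewrite ge0_ler_powR ?nnegrE ?addr_ge0 ?mulr_ge0//; lra.
by rewrite powRM// ler_wpM2l ?powR_ge0// lerDl powR_ge0.
Qed.

Let N1 : R := n.+1%:R.

(** The distance is split at the quantized value. The first part costs [eta]; the second costs at
    most [kap] per time on [good] and [D] per time off it, where [good] fails with probability at
    most [n%:R * dl]. *)
Lemma mixture_cost :
  (\int[pi]_z (dist_p p (fp_path z.1) (fp_path z.2))%:E <=
   (2 `^ p * (eta + N1 * kap + N1 * D * (n%:R * dl)))%:E)%E.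
Proof.
have [pi1 pi2] := mixture_coupling.
have h0 w : 0 <= quantization_cost w by apply: sumr_ge0 => t _; exact: powR_ge0.
have kap0 : 0 <= kap by apply: le_trans (near ord0 ord0); exact: powR_ge0.
have D0 : 0 <= D by apply: le_trans (far ord0 ord0 ord0); exact: powR_ge0.
have N0 : 0 <= N1 by rewrite ler0n.
pose g (z : Z) : R :=
  2 `^ p * ((quantization_cost z.1 + N1 * kap) + N1 * D * \1_(~` good) z).
have inth : P.-integrable setT (EFin \o quantization_cost).
  apply/integrableP; split; first exact/measurable_EFinP.
  under eq_integral do rewrite gee0_abs ?lee_fin//.
  exact: le_lt_trans cost_le (ltry _).
have mg : measurable_fun setT g.
  apply: measurable_funM => //; apply: measurable_funD.
    by apply: measurable_funD => //; apply: measurableT_comp.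
  by apply: measurable_funM => //; apply/measurable_indic/measurableC.
(* The pointwise bound by [g] is available only where the second component is an embedded path,
   which is almost sure. *)
pose S : set Z := snd @^-1` (\bigcup_(s : path) [set emb s]).
have mS : measurable (\bigcup_(s : path) [set emb s]).
  by apply: (@sub_bigcup_fin _ (fp_space y) _ (@sigma_algebra_measurable _ _)) => s.
have piS : pi S = 1%E.
  rewrite pi2// yP -[RHS](@probability_setT _ _ _ pi) piE.
  apply: eq_bigr => s _; congr (integral _ _ _).
  by rewrite preimage_setT; apply/seteqP; split => // w _; exists s.
apply: (@le_trans _ _ (\int[pi]_z (g z)%:E)%E).
  apply: (@integral_le_ae_bound _ _ _ pi S) => //.
  - by rewrite -[X in measurable X]setTI; exact: measurable_snd.
  - exact/measurable_EFinP.
  - by move=> z; rewrite lee_fin; apply: sumr_ge0 => t _; exact: powR_ge0.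
  - move=> z; rewrite lee_fin mulr_ge0 ?powR_ge0// !addr_ge0 ?mulr_ge0// indicE//.
  move=> [w y1] [s _ /= ->]; rewrite lee_fin.
  apply: (@le_trans _ _ (\sum_(t < n.+1) 2 `^ p *
     (mdist (fp_proc t w) (val t (q t w)) `^ p + mdist (val t (q t w)) (f t (s t)) `^ p))).
    apply: ler_sum => t _; apply: le_trans (powR_add_le _ _); rewrite ?mdist_ge0//.
    rewrite ge0_ler_powR ?nnegrE ?mdist_ge0 ?addr_ge0 ?mdist_ge0//.
      exact: le_trans p1.
    by rewrite /fp_path procE; exact: metric_triangle.
  rewrite -mulr_sumr ler_wpM2l ?powR_ge0// big_split/= -addrA lerD2l indicE.
  have NE c : N1 * c = \sum_(t < n.+1) c.
    by rewrite sumr_const card_ord -mulr_natl.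
  case: (boolP ((w, emb s) \in ~` good)); rewrite ?inE ?notin_setE /= => wg.
    rewrite mulr1 -mulrDr NE; apply: ler_sum => t _.
    by rewrite (le_trans (far _ _ _))// lerDr.
  rewrite mulr0 addr0 NE; apply: ler_sum => t _.
  move: wg => /contrapT [s' _ [/= ws' /(congr1 (fp_proc t))]]; rewrite !procE => ->.
  by rewrite -ws' /path_of ffunE; exact: near.
have intg1 : pi.-integrable setT (EFin \o (fun z : Z => quantization_cost z.1)).
  apply/integrableP; split.
    by apply/measurable_EFinP; apply: measurableT_comp.
  under eq_integral do rewrite gee0_abs ?lee_fin//.
  move: cost_le => /le_lt_trans -/(_ +oo%E (ltry _)).
  rewrite (_ : (\int[P]_w (quantization_cost w)%:E)%E =
      (\int[pushforward pi fst]_w (quantization_cost w)%:E)%E).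
    rewrite ge0_integral_pushforward//; first exact/measurable_EFinP.
    by move=> w _; rewrite lee_fin.
  by apply: eq_measure_integral => E mE _; exact: esym (pi1 E mE).
have intc (c : R) : pi.-integrable setT (EFin \o (fun=> c)).
  exact: finite_measure_integrable_cst.
have mgC : measurable (~` good) by exact: measurableC.
have inti : pi.-integrable setT (EFin \o (fun z => \1_(~` good) z)).
  exact: integrable_indic.
have int1 : pi.-integrable setT (EFin \o (fun z : Z => quantization_cost z.1 + N1 * kap)).
  exact: integrable_addR.
have int2 : pi.-integrable setT (EFin \o (fun z => N1 * D * \1_(~` good) z)).
  exact: integrable_scaleR.
rewrite -RintegralT_fin//; last exact/integrable_scaleR/integrable_addR.
rewrite lee_fin RintegralZl//; last exact: integrable_addR.
rewrite ler_wpM2l ?powR_ge0// RintegralD// RintegralD//.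
rewrite [X in _ + X <= _]RintegralZl// Rintegral_indic// setIT Rintegral_cst//.
have := Rintegral_fst measurableT mcost inth; rewrite preimage_setT => ->.
rewrite (_ : fine (pi setT) = 1); last by rewrite (@probability_setT _ _ _ pi).
rewrite mulr1; apply: lerD; first rewrite lerD2r.
  by rewrite -lee_fin RintegralT_fin.
rewrite ler_wpM2l ?mulr_ge0//.
have := follow_prob; have := probability_setC pi mgood.
rewrite -(fineK (fin_num_measure pi _ mgood)) => ->.
by rewrite -EFinB lee_fin /=; lra.
Qed.

End cost.

End bicausal.

(** * Discretization of a filtered process *)

Section finite_valued.
Context d (T : measurableType d) (K : set (set T)).
Hypothesis sK : sigma_algebra setT K.

Definition fin_measurable (I : finType) (h : T -> I) :=
  forall i, K (h @^-1` [set i]).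

Lemma fin_measurable_preimage (I : finType) (h : T -> I) (A : set I) :
  fin_measurable h -> K (h @^-1` A).
Proof.
move=> mh.
rewrite (_ : _ @^-1` _ =
    \bigcup_(i : I) (if i \in A then h @^-1` [set i] else set0)).
  apply: (sub_bigcup_fin sK) => i; case: ifP => _; first exact: mh.
  by rewrite -setCT; apply/(sub_setC sK)/(sub_setT sK).
apply/seteqP; split => [w Aw|w [i _]].
  by exists (h w) => //; rewrite mem_set.
by case: ifPn => // iA /= hi; rewrite hi; exact: set_mem.
Qed.

Lemma fin_measurable_comp (I J : finType) (h : T -> I) (g : I -> J) :
  fin_measurable h -> fin_measurable (g \o h).
Proof. by move=> mh j; rewrite comp_preimage; exact: fin_measurable_preimage. Qed.

Lemma fin_measurable_ffun (I J : finType) (h : J -> T -> I) :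
  (forall j, fin_measurable (h j)) ->
  fin_measurable (fun w => [ffun j => h j w]).
Proof.
move=> mh b.
rewrite (_ : _ @^-1` _ = \bigcap_(j : J) (h j @^-1` [set b j])).
  by apply: (sub_bigcap_fin sK) => j; exact: mh.
apply/seteqP; split => [w /= <- j _|w wb]; first by rewrite /= ffunE.
by apply/ffunP => j; rewrite ffunE; exact: wb.
Qed.

Lemma fin_measurable_pair (I J : finType) (h : T -> I) (g : T -> J) :
  fin_measurable h -> fin_measurable g -> fin_measurable (fun w => (h w, g w)).
Proof.
move=> mh mg [i j].
rewrite (_ : _ @^-1` _ = h @^-1` [set i] `&` g @^-1` [set j]).
  by apply: (sub_setI sK); [exact: mh|exact: mg].
by apply/seteqP; split => w /=; [move=> [-> ->]|move=> [-> ->]].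
Qed.

Lemma fin_measurable_bool (A : set T) : K A -> fin_measurable (fun w => w \in A).
Proof.
move=> KA [].
  rewrite (_ : _ @^-1` _ = A) //; apply/seteqP; split => w /=; [exact: set_mem|].
  by move=> Aw; rewrite mem_set.
rewrite (_ : _ @^-1` _ = ~` A); first exact: (sub_setC sK).
apply/seteqP; split => w /=; first by move=> /negbT; rewrite notin_setE.
by move=> Aw; rewrite memNset.
Qed.

End finite_valued.

Section conditional_family.
Context d (T : measurableType d) (R : realType) (P : probability T R).
Variable K : set (set T).
Hypothesis sK : sigma_algebra [set: T] K.
Hypothesis mK : K `<=` measurable.

(** The versions given by Radon-Nikodym sum to one only almost surely. On the exceptional set, which
    lies in [K], they are replaced by the point mass at [j0], so that they serve pointwise as
    transition probabilities. *)
Lemma cond_prob_family (J : finType) (j0 : J) (q : T -> J) :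
  fin_measurable measurable q ->
  exists a : J -> T -> R,
   [/\ forall j, sub_measurable K (a j), forall j w, 0 <= a j w,
       forall w, \sum_j a j w = 1 &
       forall j C, K C ->
         \int[P]_(w in C) a j w = fine (P (q @^-1` [set j] `&` C))].
Proof.
move=> mq.
have [b bP b0] : exists2 b : J -> T -> R,
    forall j, is_cond_prob P K (q @^-1` [set j]) (b j) & forall j w, 0 <= b j w.
  have h j := cid2 (cond_prob_ex P sK mK (mq j)).
  by exists (fun j => s2val (h j)) => j; [exact: (s2valP (h j))|exact: (s2valP' (h j))].
have mb j : sub_measurable K (b j) by case: (bP j).
have intb j : P.-integrable setT (EFin \o b j) by case: (bP j).
have bE j C : K C -> \int[P]_(w in C) b j w = fine (P (q @^-1` [set j] `&` C)).
  by move=> KC; case: (bP j) => _ _ h; rewrite /Rintegral h.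
pose sb w := \sum_j b j w.
have msb : sub_measurable K sb by apply: sub_measurable_sum.
have intsb : P.-integrable setT (EFin \o sb) by apply: integrable_sumR.
have sb1 : {ae P, forall w, sb w = cst 1 w}.
  apply: (cond_prob_uniq sK mK) => //.
  - exact: sub_measurable_cst.
  - exact: finite_measure_integrable_cst.
  move=> C KC; have mC := mK KC.
  rewrite -RintegralT_fin// /sb Rintegral_sum//.
  rewrite [RHS](_ : _ = P C); last first.
    by rewrite (eq_integral (cst 1%E))// integral_cst// mul1e.
  rewrite -[RHS]fineK ?fin_num_measure//; congr EFin.
  rewrite -(mul1r (fine _)) -Rintegral_cst//.
  rewrite [RHS](@eq_Rintegral _ _ _ P _ (fun w => \sum_j \1_(q @^-1` [set j]) w)).
    rewrite Rintegral_sum//; last by move=> j _; exact: integrable_indic.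
    by apply: eq_bigr => j _; rewrite bE// Rintegral_indic.
  move=> w _; rewrite (bigD1 (q w))//= indicE mem_set// big1 ?addr0// => j jq.
  by rewrite indicE memNset// => /= qj; rewrite qj eqxx in jq.
pose B := sb @^-1` [set~ 1].
have KB : K B by apply: msb; exact: measurableC.
have PB0 : P B = 0%E.
  case: sb1 => N [mN N0 sN].
  apply/eqP; rewrite -measure_le0 -N0; apply: le_measure; rewrite ?inE//.
  exact: mK.
pose a j w : R := b j w * \1_(~` B) w + (j == j0)%:R * \1_B w.
have aE j w : a j w = if w \in B then (j == j0)%:R else b j w.
  rewrite /a !indicE in_setC; case: (w \in B); rewrite /= ?mulr0 ?mulr1 ?add0r ?addr0//.
exists a; split => [j|j w|w|j C KC].
- apply: sub_measurableD => //; apply: sub_measurableM => //.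
  + exact: (sub_measurable_indic sK (sub_setC sK KB)).
  + exact: sub_measurable_cst.
  + exact: sub_measurable_indic.
- by rewrite aE; case: ifP.
- under eq_bigr do rewrite aE.
  case: (boolP (w \in B)) => wB.
    by rewrite (bigD1 j0)//= eqxx big1 ?addr0// => j /negbTE ->.
  by apply: contrapT => h; move: wB; rewrite notin_setE; apply.
- rewrite -bE//; congr fine; apply: ae_eq_integral.
  + exact: mK.
  + apply/measurable_funTS/measurable_EFinP; apply: (sub_measurableW mK).
    apply: sub_measurableD => //; apply: sub_measurableM => //.
    * exact: (sub_measurable_indic sK (sub_setC sK KB)).
    * exact: sub_measurable_cst.
    * exact: sub_measurable_indic.
  + by apply/measurable_funTS/measurable_EFinP; exact: (sub_measurableW mK).
  + exists B; split => //; first exact: mK.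
    move=> w /= h; apply: contrapT => /= wB; apply: h => _.
    by rewrite aE memNset.
Qed.

End conditional_family.

Section refinement.
Context d (T : measurableType d) (R : realType) (P : probability T R).
Variable K : set (set T).
Hypothesis sK : sigma_algebra [set: T] K.
Hypothesis mK : K `<=` measurable.

Lemma truncn_close (N : nat) (u v : R) : (0 < N)%N -> 0 <= u -> 0 <= v ->
  Num.truncn (N%:R * u) = Num.truncn (N%:R * v) -> u - v <= N%:R^-1.
Proof.
move=> N0 u0 v0 uv; have NR : 0 < N%:R :> R by rewrite ltr0n.
have /truncn_itv/andP[_ h1] : 0 <= N%:R * u by rewrite mulr_ge0// ltW.
have /truncn_itv/andP[h2 _] : 0 <= N%:R * v by rewrite mulr_ge0// ltW.
rewrite uv -natr1 in h1.
rewrite -(ler_pM2l NR) mulrBr mulfV ?gt_eqF//.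
lra.
Qed.

(* One backward step: the new state records [r] and a discretization of the
   conditional law of the next state given [K], so that the kernel may be read
   off the state; mixing with the uniform law turns the additive discretization
   error into the multiplicative bound. *)
Lemma refine_state (I : finType) (r : T -> I) (m : nat) (q' : T -> 'I_m.+1) (dl : R) :
  fin_measurable K r -> fin_measurable measurable q' -> 0 < dl <= 1 ->
  exists m0 (q : T -> 'I_m0.+1) (rho : 'I_m0.+1 -> I)
    (k : 'I_m0.+1 -> 'I_m.+1 -> R) (a : 'I_m.+1 -> T -> R),
  [/\ fin_measurable K q, forall w, rho (q w) = r w,
      (forall i j, 0 <= k i j) /\ (forall i, \sum_j k i j = 1),
      [/\ forall j, sub_measurable K (a j), forall j w, 0 <= a j w,
          forall w, \sum_j a j w = 1 &
          forall j C, K C ->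
            \int[P]_(w in C) a j w = fine (P (q' @^-1` [set j] `&` C))] &
      forall w j, (1 - dl) * a j w <= k (q w) j].
Proof.
move=> mr mq' /andP[dl0 dl1].
have [a [ma a0 a1 aP]] := cond_prob_family P sK mK ord0 mq'.
(* [N] exceeds [m.+1 / dl], so the rounding error 1/N is covered by the mass [dl / m.+1] that the
   uniform part gives to each state. *)
pose N := (Num.truncn (m.+1%:R / dl)).+1.
have NR : 0 < N%:R :> R by rewrite ltr0n.
have mR : 0 < m.+1%:R :> R by rewrite ltr0n.
have Ndl : N%:R^-1 <= dl / m.+1%:R.
  rewrite ler_pdivlMr// mulrC ler_pdivrMr// mulrC -ler_pdivrMr//.
  by rewrite ltW// truncnS_gt.
have ale1 j w : a j w <= 1 by rewrite -(a1 w) (bigD1 j)//= lerDl sumr_ge0.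
pose lev j w : 'I_N.+1 := inord (Num.truncn (N%:R * a j w)).
have levK j w : lev j w = Num.truncn (N%:R * a j w) :> nat.
  rewrite inordK// ltnS -(ler_nat R).
  have /truncn_itv/andP[h _] : 0 <= N%:R * a j w by rewrite mulr_ge0// ltW.
  by rewrite (le_trans h)// ler_piMr// ltW.
have mlev j : fin_measurable K (lev j).
  move=> i.
  rewrite (_ : _ @^-1` _ = a j @^-1` ((fun u => N%:R * u) @^-1` `[i%:R, i.+1%:R[)).
    apply: ma; rewrite -[X in measurable X]setTI.
    by apply: (@measurable_funM _ _ _ setT (cst N%:R) id) => //; exact: measurable_itv.
  have Na0 w : 0 <= N%:R * a j w by rewrite mulr_ge0// ltW.
  apply/seteqP; split => w /=; rewrite in_itv /=.
    by move=> <-; rewrite levK; exact: truncn_itv.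
  by move=> h; apply/val_inj => /=; rewrite levK; apply/eqP; rewrite truncn_eq.
pose cell w := (r w, [ffun j => lev j w]).
have mcell : fin_measurable K cell.
  by apply: fin_measurable_pair => //; exact: fin_measurable_ffun.
pose Q : finType := (I * {ffun 'I_m.+1 -> 'I_N.+1})%type.
have cQ : (#|Q|.-1.+1 = #|Q|)%N by rewrite prednK//; apply/card_gt0P; exists (cell point).
pose enc (c : Q) : 'I_(#|Q|.-1).+1 := cast_ord (esym cQ) (enum_rank c).
pose dec (i : 'I_(#|Q|.-1).+1) : Q := enum_val (cast_ord cQ i).
have encK : cancel enc dec by move=> c; rewrite /dec /enc cast_ordKV enum_rankK.
(* The kernel reads the conditional law at one chosen point of each cell, so it depends on the state
   only. In an empty cell the default [point] does as well, since the law there is again a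
   probability. *)
pose rep i : T := xget point (cell @^-1` [set dec i]).
have repE w : cell (rep (enc (cell w))) = cell w.
  rewrite /rep; case: xgetP => [w' _ /=|]; first by rewrite encK.
  by move=> /(_ w) /=; rewrite encK.
exists _, (enc \o cell), (fun i => (dec i).1),
  (fun i j => (1 - dl) * a j (rep i) + dl / m.+1%:R), a.
have dl1' : 0 <= 1 - dl by rewrite subr_ge0.
split=> //.
- exact: fin_measurable_comp.
- by move=> w; rewrite /= encK.
- split=> [i j|i].
    by rewrite addr_ge0// ?mulr_ge0// ?invr_ge0 ltW.
  rewrite big_split/= -mulr_sumr a1 mulr1 sumr_const card_ord.
  rewrite -[X in _ + X]mulr_natr divfK ?gt_eqF//.
  by rewrite subrK.
move=> w j /=; set v := rep _.
have := congr1 (fun c : Q => val (c.2 j)) (repE w); rewrite /= !ffunE.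
rewrite !levK => /esym/(truncn_close (ltn0Sn _) (a0 _ _) (a0 _ _)); rewrite -/v => av.
have : (1 - dl) * (a j w - a j v) <= 1 * N%:R^-1.
  apply: (@le_trans _ _ ((1 - dl) * N%:R^-1)); first by rewrite ler_wpM2l.
  by rewrite ler_wpM2r ?invr_ge0// lerBlDr lerDl ltW.
rewrite mul1r => h; rewrite -lerBlDl -mulrBr (le_trans h)//.
Qed.

End refinement.

Section polish.
Context (R : realType) (S : polishMetricType R).

Lemma open_mdist_lt (y : S) (c : R) : open [set z : S | mdist z y < c].
Proof.
rewrite openE => z /= zy; rewrite /interior -nbhs_ballE.
exists (c - mdist z y) => /=; first by rewrite subr_gt0.
move=> u; rewrite ballEmdist/= => zu.
by rewrite (le_lt_trans (metric_triangle u z y))// metric_sym -ltrBrDr.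
Qed.

Lemma dense_seq : exists u : nat -> S, forall z (c : R), 0 < c ->
  exists i, mdist z (u i) < c.
Proof.
have [D /countable_injP[f finj] dD] := @separable_subproof R S.
exists (fun i => xget point [set z | D z /\ f z = i]) => z c c0.
have [|u [/= uz Du]] := dD _ _ (open_mdist_lt z c).
  by exists z; rewrite /= mdistxx.
exists (f u); rewrite metric_sym; case: xgetP => [v _ [Dv fvu]|/(_ u)[]//].
by rewrite (finj v u) ?inE.
Qed.

End polish.

(** * Finite quantization of one coordinate *)

Section base_quantization.
Context d (T : measurableType d) (R : realType) (P : probability T R).
Variable K : set (set T).
Hypothesis sK : sigma_algebra [set: T] K.
Hypothesis mK : K `<=` measurable.
Context (S : polishMetricType R) (Z : T -> S) (p : R) (x0 : S).
Hypothesis ZK : forall B, open B -> K (Z @^-1` B).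
Hypothesis p1 : 1 <= p.

Lemma sub_measurable_mdist (y : S) : sub_measurable K (fun w => mdist (Z w) y).
Proof.
apply/(sub_measurableP sK) => _.
apply: (measurability _ (RGenInftyO.measurableE R)) => //.
move=> _ [_ [r ->] <-]; rewrite setTI (sub_algebraE sK).
rewrite (_ : _ @^-1` _ = Z @^-1` [set z | mdist z y < r]).
  exact/ZK/open_mdist_lt.
by apply/seteqP; split => w /=; rewrite in_itv.
Qed.

Let mZ y : measurable_fun setT (fun w => mdist (Z w) y `^ p).
Proof.
have h := sub_measurableW mK (sub_measurable_mdist y).
have h2 := (measurableT_comp (measurable_powR p) h).
exact: h2.
Qed.

Lemma measurable_quantized (I : finType) (v : I -> S) (r : T -> I) :
  fin_measurable K r -> measurable_fun setT (fun w => mdist (Z w) (v (r w)) `^ p).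
Proof.
move=> mr.
rewrite (_ : (fun _ => _) =
    fun w => \sum_i mdist (Z w) (v i) `^ p * \1_(r @^-1` [set i]) w).
  apply: measurable_sum => i; apply: measurable_funM => //.
  exact/measurable_indic/mK/mr.
apply/funext => w; rewrite (bigD1 (r w))//= indicE mem_set// mulr1.
rewrite big1 ?addr0// => i ir; rewrite indicE memNset ?mulr0// => /= ri.
by rewrite ri eqxx in ir.
Qed.

Hypothesis moment : (\int[P]_w (mdist (Z w) x0 `^ p)%:E < +oo)%E.

(** Values within [c] of one of the first [m] points of a dense sequence go to such a point, all
    others to [x0]. The set of the others shrinks to the empty set as [m] grows, so by dominated
    convergence, with the moment about [x0] as dominating function, its cost becomes small. *)
Lemma base_quantization (e : R) : 0 < e ->
  exists (I : finType) (v : I -> S) (r : T -> I), fin_measurable K r /\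
    (\int[P]_w (mdist (Z w) (v (r w)) `^ p)%:E <= e%:E)%E.
Proof.
move=> e0; have p0 : 0 < p by apply: lt_le_trans p1.
pose c := (e / 2) `^ p^-1.
have c0 : 0 < c by rewrite powR_gt0// divr_gt0.
have cp : c `^ p = e / 2.
  by rewrite -powRrM mulVf ?gt_eqF// powRr1// divr_ge0// ltW.
have [u uP] := dense_seq S.
pose U i : set T := [set w | mdist (Z w) (u i) < c].
have KU i : K (U i) by exact: (ZK (open_mdist_lt (u i) c)).
pose V m : set T := \bigcap_(i : 'I_m) ~` U i.
have mV m : measurable (V m).
  by apply/mK/(sub_bigcap_fin sK) => i; exact: sub_setC.
pose g w : \bar R := (mdist (Z w) x0 `^ p)%:E.
have g0 w : (0 <= g w)%E by rewrite lee_fin powR_ge0.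
have mg : measurable_fun setT g by exact/measurable_EFinP.
have intg : P.-integrable setT g.
  by apply/integrableP; split=> //; under eq_integral do rewrite gee0_abs//.
pose h m w : \bar R := (g w * (\1_(V m) w)%:E)%E.
have mh m : measurable_fun setT (h m).
  by apply: emeasurable_funM => //; apply/measurable_EFinP/measurable_indic.
have hcvg : (\int[P]_w h m w @[m --> \oo] --> \int[P]_w (cst 0 w : \bar R))%E.
  apply: (@dominated_cvg _ _ _ P setT measurableT h (cst 0%E) g) => //.
  - move=> w _; apply: cvg_near_cst.
    have [i iw] := uP (Z w) c c0.
    exists i.+1 => // m im; rewrite /h indicE memNset ?mule0//.
    by move=> /(_ (Ordinal im) I); apply.
  - move=> m w _; rewrite /h indicE; case: (w \in V m).
      by rewrite mule1 gee0_abs.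
    by rewrite mule0 abse0.
rewrite integral0 in hcvg.
have [m hm] : exists m, (\int[P]_w h m w <= (e / 2)%:E)%E.
  apply: contrapT => /forallNP hm.
  have : ((e / 2)%:E <= 0)%E.
    apply: (cvge_ge _ hcvg); apply: nearW => m.
    by have /negP := hm m; rewrite -ltNge => /ltW.
  by rewrite lee_fin leNgt divr_gt0.
pose b w : {ffun 'I_m -> bool} := [ffun i : 'I_m => w \in U i].
have mb : fin_measurable K b.
  by apply: fin_measurable_ffun => // i; exact: fin_measurable_bool.
exists (option 'I_m), (fun i : option 'I_m => if i is Some i then u i else x0),
  ((fun b : {ffun 'I_m -> bool} => [pick i | b i]) \o b).
split; first exact: fin_measurable_comp.
apply: (@le_trans _ _ (\int[P]_w ((e / 2)%:E + h m w))%E).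
  apply: ge0_le_integral_nomeas => w; first by rewrite lee_fin powR_ge0.
  rewrite /=; case: pickP => [i|nb].
    rewrite ffunE inE /U /= => wi.
    apply: (@le_trans _ _ (e / 2)%:E).
      by rewrite lee_fin -cp ge0_ler_powR ?nnegrE ?mdist_ge0 ?ltW.
    by rewrite leeDl// mule_ge0// lee_fin indicE.
  rewrite /h indicE mem_set ?mule1; last first.
    by move=> i _ /= wi; have := nb i; rewrite ffunE mem_set.
  by rewrite leeDr// lee_fin divr_ge0// ltW.
rewrite ge0_integralD//; last 2 first.
- by move=> w _; rewrite lee_fin divr_ge0// ltW.
- by move=> w _; rewrite mule_ge0// lee_fin indicE.
rewrite integral_cstT.
rewrite [leRHS](_ : _ = (e / 2)%:E + (e / 2)%:E)%E; first by rewrite leeD2l.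
by rewrite -EFinD; congr EFin; lra.
Qed.

End base_quantization.

(** * Backward construction of states and kernels *)

Section chain.
Context (R : realType) (n : nat) (X : 'I_n.+1 -> polishMetricType R).
Variable x : filtered_process X.
Local Notation T := (fp_space x).
Local Notation P := (fp_prob x).
Local Notation F := (@filt_nat R n X x).
Context (I : 'I_n.+1 -> finType) (r : forall t, T -> I t) (dl : R).
Hypothesis mr : forall t, fin_measurable (fp_filt t) (r t).
Hypothesis dl01 : 0 < dl <= 1.

(** The number of states is known only after the later times have been treated, so it is packed with
    the state map. *)
Let stage := {m : nat & T -> 'I_m.+1}.

Let refines (t : 'I_n.+1) (s : stage) :=
  fin_measurable (fp_filt t) (projT2 s) /\
  exists rho : 'I_(projT1 s).+1 -> I t, forall w, rho (projT2 s w) = r t w.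

Let linked_by (t : nat) (s s' : stage)
    (ka : ('I_(projT1 s).+1 -> 'I_(projT1 s').+1 -> R) * ('I_(projT1 s').+1 -> T -> R)) :=
  [/\ (forall i j, 0 <= ka.1 i j) /\ (forall i, \sum_j ka.1 i j = 1),
      [/\ forall j, sub_measurable (F t) (ka.2 j), forall j w, 0 <= ka.2 j w,
          forall w, \sum_j ka.2 j w = 1 &
          forall j C, F t C -> \int[P]_(w in C) ka.2 j w =
            fine (P (projT2 s' @^-1` [set j] `&` C))] &
      forall w j, (1 - dl) * ka.2 j w <= ka.1 (projT2 s w) j].

Let linked (t : nat) (s s' : stage) := exists ka, @linked_by t s s' ka.

Let fin_measurableW (t : 'I_n.+1) (s : stage) :
  refines t s -> fin_measurable measurable (projT2 s).
Proof. by move=> [ms _] j; exact: fp_filt_measurable (ms j). Qed.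

Let refine_step (t : nat) (s' : stage) : (t <= n)%N ->
  fin_measurable measurable (projT2 s') ->
  exists2 s, refines (inord t) s & linked t s s'.
Proof.
move=> tn ms'.
have [m0 [q [rho [k [a [mq rhoE k01 aP ka]]]]]] :=
  refine_state P (@fp_filt_sigma _ _ _ x (inord t)) (@fp_filt_measurable _ _ _ x (inord t))
    (@mr (inord t)) ms' dl01.
exists (existT _ m0 q); first by split=> //; exists rho.
exists (k, a); split=> //.
have -> : F t = fp_filt (inord t) by rewrite -filt_natE inordK.
by [].
Qed.

Let stages_ex (j : nat) : (j <= n)%N -> exists st : nat -> stage,
  (forall t, (n - j <= t <= n)%N -> refines (inord t) (st t)) /\
  (forall t, (n - j <= t < n)%N -> linked t (st t) (st t.+1)).
Proof.
elim: j => [_|j ih jn].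
  (* The terminal time has no successor: refining against a one-point stage gives the base case, and
     the link to that dummy stage is discarded. *)
  have [|s rs _] := @refine_step n (existT _ 0%N (fun=> ord0)) (leqnn n).
    move=> j /=; rewrite (_ : _ @^-1` _ = setT); first exact: measurableT.
    apply/seteqP; split => // w _; exact: esym (ord1 (j : 'I_1)).
  exists (fun=> s); split => t; rewrite subn0.
    by rewrite -eqn_leq => /eqP <-.
  by case/andP => h tn; have := leq_ltn_trans h tn; rewrite ltnn.
have [st [rst lst]] := ih (ltnW jn).
set t0 := (n - j.+1)%N.
have t0S : t0.+1 = (n - j)%N by rewrite /t0 -subSn// subSS.
have t0n : (t0 < n)%N by rewrite t0S leq_subr.
have rS : refines (inord t0.+1) (st t0.+1) by apply: rst; rewrite t0S leqnn leq_subr.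
have [s rs ls] := refine_step (ltnW t0n) (fin_measurableW rS).
exists (fun t => if t == t0 then s else st t); split=> t /andP[h1 h2].
  case: eqVneq => [->//|tt0]; apply: rst.
  by rewrite h2 andbT -t0S ltn_neqAle eq_sym tt0.
have -> : (t.+1 == t0) = false by apply/eqP => h; rewrite -h ltnn in h1.
case: eqVneq => [->//|tt0]; apply: lst.
by rewrite h2 andbT -t0S ltn_neqAle eq_sym tt0.
Qed.

(** The stages, of different sizes, are embedded through the numerical values of their states into a
    common state space, as large as the largest stage; kernels and conditional probabilities are
    zero on targets outside a stage. *)
Lemma chain_ex : exists (M : nat) (q : nat -> T -> 'I_M.+1)
    (rho : forall t : 'I_n.+1, 'I_M.+1 -> I t)
    (k : nat -> 'I_M.+1 -> 'I_M.+1 -> R) (a : nat -> 'I_M.+1 -> T -> R),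
  [/\ forall u j, F u (q u @^-1` [set j]),
      forall (t : 'I_n.+1) w, rho t (q t w) = r t w,
      (forall u i j, 0 <= k u i j) /\
        (forall u i, (u < n)%N -> \sum_j k u i j = 1),
      [/\ forall u j, (u < n)%N -> sub_measurable (F u) (a u j),
          forall u j w, (u < n)%N -> 0 <= a u j w,
          forall u w, (u < n)%N -> \sum_j a u j w = 1 &
          forall u j C, (u < n)%N -> F u C ->
            \int[P]_(w in C) a u j w = fine (P (q u.+1 @^-1` [set j] `&` C))] &
      forall u w j, (u < n)%N -> (1 - dl) * a u j w <= k u (q u w) j].
Proof.
have [st [rst lst]] := stages_ex (leqnn n).
have {}rst (t : 'I_n.+1) : refines t (st t).
  by have := rst t; rewrite subnn leq0n -ltnS ltn_ord inord_val => /(_ isT).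
have {}lst t : (t < n)%N -> linked t (st t) (st t.+1).
  by move=> tn; apply: lst; rewrite subnn tn.
have [ka kaP] : exists ka : forall t, ('I_(projT1 (st t)).+1 ->
      'I_(projT1 (st t.+1)).+1 -> R) * ('I_(projT1 (st t.+1)).+1 -> T -> R),
    forall t, (t < n)%N -> linked_by t (ka t).
  have h t : exists ka, (t < n)%N -> linked_by (s := st t) (s' := st t.+1) t ka.
    case: (ltnP t n) => [/lst[ka kaP]|_]; first by exists ka.
    by exists (fun _ _ => 0, fun _ _ => 0).
  exists (fun t => projT1 (cid (h t))) => t; exact: (projT2 (cid (h t))).
have [rho rhoE] : exists rho : forall t : 'I_n.+1, 'I_(projT1 (st t)).+1 -> I t,
    forall t w, rho t (projT2 (st t) w) = r t w.
  have h (t : 'I_n.+1) := cid (rst t).2.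
  exists (fun t => projT1 (h t)) => t; exact: (projT2 (h t)).
pose m t := projT1 (st t).
pose M := (\max_(t < n.+1) m t)%N.
have mM t : (t <= n)%N -> (m t <= M)%N.
  by move=> tn; have := @leq_bigmax _ (fun t : 'I_n.+1 => m t) (Ordinal (tn : (t < n.+1)%N)).
pose q u w : 'I_M.+1 := if (u <= n)%N then inord (projT2 (st u) w) else ord0.
have qE u w : (u <= n)%N -> q u w = projT2 (st u) w :> nat.
  move=> un; rewrite /q un inordK// ltnS.
  by apply: leq_trans (mM u un); rewrite -ltnS.
have qK u w : (u <= n)%N -> inord (q u w) = projT2 (st u) w.
  by move=> un; apply/val_inj => /=; rewrite inordK qE.
have q_fiber u (j : 'I_M.+1) : (u <= n)%N -> q u @^-1` [set j] =
    if (j <= m u)%N then projT2 (st u) @^-1` [set inord j] else set0.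
  move=> un; apply/seteqP; split => w /=.
    move=> <-; rewrite qE// -ltnS ltn_ord /=; apply/val_inj => /=.
    by rewrite inordK// qE.
  case: ifP => // jm /= h; apply/val_inj => /=; rewrite qE// h inordK//.
have mq u j : F u (q u @^-1` [set j]).
  have F0 : F u set0.
    rewrite -setCT; apply/(sub_setC (@filt_nat_sigma _ _ _ x u)).
    exact: (sub_setT (@filt_nat_sigma _ _ _ x u)).
  have FT : F u setT by exact: (sub_setT (@filt_nat_sigma _ _ _ x u)).
  case: (leqP u n) => un.
    rewrite q_fiber//; case: ifP => // _.
    have [h _] := rst (Ordinal (un : (u < n.+1)%N)).
    by have := h (inord j); rewrite -filt_natE.
  rewrite /q leqNgt un /=; have [->|j0] := eqVneq j ord0.
    by rewrite (_ : _ @^-1` _ = setT)//; apply/seteqP; split.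
  rewrite (_ : _ @^-1` _ = set0)//; apply/seteqP; split => // w /= j0'.
  by rewrite -j0' eqxx in j0.
have sum_narrow u (g : 'I_(m u).+1 -> R) : (u <= n)%N ->
    \sum_(j < M.+1) (if (j <= m u)%N then g (inord j) else 0) = \sum_j g j.
  move=> un; rewrite -big_mkcond/=.
  rewrite -(big_ord_widen _ (fun j => g (inord j)) (mM u un : (m u < M.+1)%N)).
  by apply: eq_bigr => j _; rewrite inord_val.
(* [inord] reads a source outside its stage as state 0, so that the rows of states never visited sum
   to one too. *)
exists M, q, (fun t i => rho t (inord i)),
  (fun u i j => if (u < n)%N && (j <= m u.+1)%N then (ka u).1 (inord i) (inord j) else 0),
  (fun u j w => if (j <= m u.+1)%N then (ka u).2 (inord j) w else 0).
split=> //.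
- by move=> t w; rewrite qK ?rhoE// -ltnS.
- split=> [u i j|u i un].
    by case: ifP => // /andP[un _]; have [[k0 _] _ _] := kaP u un.
  rewrite un /=; have [[_ k1] _ _] := kaP u un.
  exact: etrans (sum_narrow u.+1 (fun j => (ka u).1 (inord i) j) un) (k1 _).
- split=> [u j un|u j w un|u w un|u j C un FC].
  + have [_ [ma _ _ _] _] := kaP u un; case: (j <= m u.+1)%N => //.
    exact: sub_measurable_cst (@filt_nat_sigma _ _ _ x u) _.
  + by have [_ [_ a0 _ _] _] := kaP u un; case: ifP.
  + have [_ [_ _ a1 _] _] := kaP u un.
    exact: etrans (sum_narrow u.+1 (fun j => (ka u).2 j w) un) (a1 w).
  + have [_ [_ _ _ aP] _] := kaP u un; rewrite q_fiber//; case: (j <= m u.+1)%N.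
      exact: aP.
    rewrite set0I measure0 /= Rintegral_cst ?mul0r//.
    exact: filt_nat_measurable FC.
- move=> u w j un; rewrite un /=; have [_ _ h] := kaP u un.
  case: ifP => _; last by rewrite mulr0.
  by rewrite qK ?(ltnW un).
Qed.

End chain.

(** * The approximating processes *)

Section perturbation.
Context (R : realType) (S : polishMetricType R).
Hypothesis noiso : no_isolated_points S.

Lemma not_isolated_ball (z : S) (c : R) : 0 < c ->
  exists2 z', z' != z & mdist z z' < c.
Proof.
move=> c0; apply: contrapT => h.
have : isolated [set: S] z.
  split; first by rewrite in_setT.
  exists [set u | mdist u z < c].
    by apply: open_nbhs_nbhs; split; [exact: open_mdist_lt|rewrite /= mdistxx].
  rewrite setIT; apply/seteqP; split => u /= uz; last by rewrite uz mdistxx.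
  by apply: contrapT => /eqP uNz; apply: h; exists u => //; rewrite metric_sym.
by move: noiso; rewrite /no_isolated_points => ->.
Qed.

(** The radius is shrunk below the distance from [z] to every point of [A] other than [z]; since [z]
    is not isolated, the smaller ball contains a point other than [z], which then avoids [A]. *)
Lemma avoid_ball (z : S) (c : R) (A : seq S) : 0 < c ->
  exists2 z', z' \notin A & mdist z z' < c.
Proof.
move=> c0.
have [b [b0 bc bA]] : exists b : R, [/\ 0 < b, b <= c &
    forall y, y \in A -> y != z -> b <= mdist z y].
  elim: A => [|y A [b [b0 bc bA]]]; first by exists c.
  have [->|yz] := eqVneq y z.
    by exists b; split=> // y'; rewrite inE => /predU1P[->|/bA//]; rewrite eqxx.
  exists (Num.min b (mdist z y)); split.
  - by rewrite lt_min b0 mdist_gt0 eq_sym.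
  - by rewrite ge_min bc.
  - move=> y'; rewrite inE ge_min => /predU1P[-> _|y'A y'z]; first by rewrite lexx orbT.
    by rewrite bA.
have [z' z'z zz'] := not_isolated_ball z b0.
exists z'; last exact: lt_le_trans zz' bc.
by apply/negP => /bA /(_ z'z); rewrite leNgt zz'.
Qed.

(** States sharing a quantized value must still get different values, so that the process reveals
    its state. The values are chosen one after another, each avoiding the earlier ones. *)
Lemma perturb_injective (m : nat) (v : 'I_m -> S) (c : R) : 0 < c ->
  exists2 f : 'I_m -> S, injective f & forall i, mdist (v i) (f i) < c.
Proof.
move=> c0.
suff [f finj fv] : exists2 f : nat -> S,
    {in [pred i | (i < m)%N] &, injective f} &
    forall i (im : (i < m)%N), mdist (v (Ordinal im)) (f i) < c.
  exists (fun i => f i) => [i j /finj ij|[i im]]; last exact: fv.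
  by apply/val_inj/ij; rewrite inE.
elim: m v => [v|m ih v]; first by exists (fun=> point).
have [f finj fv] := ih (fun i => v (widen_ord (leqnSn m) i)).
have [z zA vz] := avoid_ball (v ord_max) [seq f i | i <- iota 0 m] c0.
exists (fun i => if i == m then z else f i).
  have fz i : (i < m)%N -> f i <> z.
    move=> im fi; move/negP: zA; apply; apply/mapP; exists i => //.
    by rewrite mem_iota.
  have lt i : (i < m.+1)%N -> i != m -> (i < m)%N.
    by rewrite ltnS ltn_neqAle => -> ->.
  move=> i j; rewrite !inE => im jm.
  case: eqVneq => [->|iNm]; case: eqVneq => [->//|jNm].
  - by move=> /esym/fz; case; exact: lt.
  - by move=> /fz; case; exact: lt.
  - by apply: finj; rewrite inE; exact: lt.
move=> i im; case: eqVneq => [imE|iNm].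
  by rewrite (_ : Ordinal im = ord_max)//; apply/val_inj.
have im' : (i < m)%N by rewrite ltn_neqAle iNm.
have := fv i im'; rewrite (_ : widen_ord _ _ = Ordinal im)//; exact/val_inj.
Qed.

End perturbation.

Lemma closed_borel1 (R : realType) (S : polishMetricType R) (z : S) :
  measurable ([set z] : set (borel S)).
Proof.
rewrite -[X in measurable X]setCK; apply: measurableC.
apply: sub_gen_smallest; apply: closed_openC.
exact/accessible_closed_set1/hausdorff_accessible/metric_hausdorff.
Qed.

Lemma finite_borel (R : realType) (S : polishMetricType R) (J : finType)
  (A : set J) (f : J -> S) : measurable (f @` A : set (borel S)).
Proof.
rewrite (_ : f @` A = \bigcup_(j : J) (if j \in A then [set f j] else set0)).
  apply: (@sub_bigcup_fin _ (borel S) _ (sigma_algebra_measurable _)) => j.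
  by case: ifP => _; [exact: closed_borel1|exact: measurable0].
apply/seteqP; split => [_ [j Aj <-]|z [j _]].
  by exists j => //; rewrite mem_set.
by case: ifPn => // jA ->; exists j => //; exact: set_mem.
Qed.

Definition path_space (n M : nat) : Type := {ffun 'I_n.+1 -> 'I_M.+1}.

HB.instance Definition _ n M := Finite.on (path_space n M).
HB.instance Definition _ n M := isPointed.Build (path_space n M) [ffun=> ord0].
HB.instance Definition _ n M := @isMeasurable.Build default_measure_display
  (path_space n M) discrete_measurable discrete_measurable0
  discrete_measurableC discrete_measurableU.

(** * The chain as a process on the finite path space *)

Section finite_process.
Context (R : realType) (n : nat) (X : 'I_n.+1 -> polishMetricType R) (M : nat).
Local Notation state := 'I_M.+1.
Local Notation path := (path_space n M).
Variable f : forall t : 'I_n.+1, state -> X t.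
Variable Q : probability path R.

(** The unions of atoms; one implication suffices because [agree t] is symmetric. *)
Definition path_filt (t : nat) : set (set path) :=
  [set A | forall s s', agree t s s' -> A s -> A s'].

Lemma path_filt_sigma (t : 'I_n.+1) : sigma_algebra [set: path] (path_filt t).
Proof.
split=> [s s' _ []|A FA s s' ss'|A FA s s' ss' [i _ Ai]].
- rewrite setTD => As; apply: contra_not As; apply: FA; by rewrite agree_sym.
- by exists i => //; exact: FA Ai.
Qed.

Lemma path_filt_measurable (t : 'I_n.+1) : path_filt t `<=` measurable.
Proof. by []. Qed.

Lemma path_filt_mono (t u : 'I_n.+1) : (t <= u)%N -> path_filt t `<=` path_filt u.
Proof. by move=> tu A FA s s' /(agree_le tu); exact: FA. Qed.

Definition path_proc t : path -> X t := fun s => f t (s t).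

Lemma path_adapted t :
  gen_by (path_proc t : path -> borel (X t)) `<=` path_filt t.
Proof.
move=> _ [B mB <-] s s' /agreeP ss' [_ /= Bs]; split => //=.
by rewrite /path_proc -ss'.
Qed.

Definition finite_process : filtered_process X :=
  @FilteredProcess _ _ X _ path Q path_filt path_filt_sigma
    path_filt_measurable path_filt_mono path_proc path_adapted.

Lemma finite_process_finite : finite_space finite_process.
Proof. exact: (@finite_finset path). Qed.

Context (mu : path -> R) (k : nat -> state -> state -> R).
Hypothesis QE : forall D, Q D = (\sum_(s | s \in D) mu s)%:E.
Hypothesis k0 : forall u i j, 0 <= k u i j.
Hypothesis k1 : forall u i, (u < n)%N -> \sum_j k u i j = 1.
(** The Markov property of [mu] with kernel [k]: at each time, a function of the past times the
    weight of the future. *)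
Hypothesis muE : forall t : nat, (t <= n)%N -> exists2 I : path -> R,
  (forall s s', agree t s s' -> I s = I s') &
  forall s, mu s = I s * tail_weight k t s.
Hypothesis finj : forall t, injective (f t).

Let intQ (g : path -> R) : Q.-integrable setT (EFin \o g).
Proof.
apply: (@bounded_integrable _ _ _ _ _ (\sum_s `|g s|)) => // s.
by rewrite (bigD1 s)//= lerDl sumr_ge0.
Qed.

Lemma Rintegral_finite (C : set path) (g : path -> R) :
  \int[Q]_(s in C) g s = \sum_(s | s \in C) mu s * g s.
Proof.
transitivity (\int[Q]_(s in C) \sum_s' g s' * \1_[set s'] s).
  apply: eq_Rintegral => s _; rewrite (bigD1 s)//= indicE mem_set// mulr1.
  rewrite big1 ?addr0// => s' s's; rewrite indicE memNset ?mulr0// => /= ss'.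
  by rewrite ss' eqxx in s's.
rewrite Rintegral_sum//.
rewrite [RHS]big_mkcond; apply: eq_bigr => s _.
rewrite RintegralZl//; last by apply: integrable_onR => //; exact: intQ.
rewrite Rintegral_indic// QE /=; case: ifPn => sC.
  rewrite (big_pred1 s) 1?mulrC// => s'; rewrite in_setI.
  apply/andP/eqP => [[]|->]; first by rewrite inE.
  by split=> //; rewrite inE.
rewrite big_pred0 ?mulr0// => s'; rewrite in_setI; apply/negbTE/negP.
by move=> /andP[]; rewrite inE /= => ->; apply/negP.
Qed.

(** The conditional law is the image of [k t (s t0)] under [f t1]. It depends on the present state
    alone, which the injectivity of [f t0] recovers from the present value. *)
Lemma finite_process_markov : Defs.markov finite_process.
Proof.
move=> t t0 t1.
have tn : (t < n)%N by [].
have t0E : inord t = t0 by apply/val_inj => /=; rewrite inordK// ltnS ltnW.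
have t1E : inord t.+1 = t1 by apply/val_inj => /=; rewrite inordK.
have [kap kapE] : exists kap : path -> probability (borel (X t1)) R,
    forall s B, fine (kap s B) = \sum_(j | f t1 j \in B) k t (s t0) j.
  have h (s : path) : exists K : probability (borel (X t1)) R,
      forall B, fine (K B) = \sum_(j | f t1 j \in B) k t (s t0) j.
    have [K KE] := @mixture_ex _ _ _ Q state _ (borel (X t1))
      (fun j => cst (f t1 j : borel (X t1))) (fun j => cst (k t (s t0) j))
      (fun=> measurable_cst _) (fun=> measurable_cst _) (fun j _ => k0 t (s t0) j)
      (fun _ => k1 (s t0) tn).
    exists K => B.
    rewrite KE [RHS]big_mkcond -[RHS]/(fine (_%:E)) -sumEFin; congr fine.
    apply: eq_bigr => j _; case: ifPn => fB.
      rewrite (_ : _ @^-1` _ = setT); first exact: integral_cstT.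
      by apply/seteqP; split => // s' _; exact: set_mem.
    rewrite (_ : _ @^-1` _ = set0) ?integral_set0//.
    by apply/seteqP; split => // s' /= h; move: fB; rewrite mem_set.
  exists (fun s => projT1 (cid (h s))) => s; exact: (projT2 (cid (h s))).
exists kap.
(* The two conditionings in the definition are the extreme cases of a sigma-algebra between that of
   the present value and [path_filt t0]; one argument covers both. *)
suff H (G : set (set path)) : G `<=` path_filt t0 ->
    gen_by (path_proc t0 : path -> borel (X t0)) `<=` G ->
    is_cond_law Q G (path_proc t1) kap.
  by split; apply: H => //; exact: path_adapted.
move=> GF GG B mB; split.
- move=> D mD; apply: GG.
  exists (f t0 @` [set i | D (\sum_(j | f t1 j \in B) k t i j)]).
    exact: finite_borel.
  rewrite setTI; apply/seteqP; split => s /=.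
    by rewrite kapE => -[i Di] /finj <-.
  by rewrite kapE => Ds; exists (s t0).
- exact: intQ.
move=> C /GF FC.
have CC s s' : agree t s s' -> (s \in C) = (s' \in C).
  move=> ss'; apply/idP/idP; rewrite !inE; apply: FC => //.
  by rewrite agree_sym.
have mC : measurable C by [].
rewrite -(RintegralT_fin (intQ _) mC).
rewrite Rintegral_finite QE; congr EFin.
have [I IE muI] := muE (ltnW tn).
pose a (s : path) : R := (f t1 (s t1) \in B)%:R.
transitivity (\sum_(s | s \in C) I s * tail_weight k t s *
    (\sum_(s' | agree t s s') tail_weight k t s' * a s')).
  apply: eq_bigr => s _; rewrite -muI kapE; congr (_ * _).
  have tw : forall s' : path, \sum_(s'' | agree t.+1 s' s'') tail_weight k t.+1 s'' = 1.
    by move=> s'; exact: tail_weight_sum.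
  have := tail_weight_next s (fun j => (f t1 j \in B)%:R) tn tw.
  rewrite t0E t1E => ->; rewrite big_mkcond; apply: eq_bigr => j _.
  by case: (f t1 j \in B); rewrite ?mulr1 ?mulr0.
rewrite tail_weight_average//; last exact: ltnW.
rewrite big_mkcond [RHS]big_mkcond; apply: eq_bigr => s _.
rewrite in_setI andbC -muI; case: (s \in C) => //=; rewrite /a.
have -> : (s \in path_proc t1 @^-1` B) = (f t1 (s t1) \in B).
  by apply/idP/idP; rewrite !inE.
by case: (_ \in B); rewrite ?mulr1 ?mulr0.
Qed.

End finite_process.

(** * The chain as a plain process *)

Section plain_process.
Context (R : realType) (n : nat) (X : 'I_n.+1 -> polishMetricType R) (M : nat).
Local Notation state := 'I_M.+1.
Local Notation path := {ffun 'I_n.+1 -> 'I_M.+1}.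
Local Notation XX := (borel (prod_topology X)).
Variable f : forall t : 'I_n.+1, state -> X t.
Hypothesis finj : forall t, injective (f t).

Definition plain_path (s : path) : XX := fun t => f t (s t).

(** The sets that do not separate paths agreeing up to [t] form a sigma-algebra, which contains the
    generators because these look at coordinates up to [t] only. *)
Lemma coord_filt_agree (t : 'I_n.+1) (A : set XX) : @coord_filt R n X t A ->
  forall s s', agree t s s' -> (plain_path s \in A) = (plain_path s' \in A).
Proof.
pose C := [set A : set XX | forall s s', agree t s s' ->
  A (plain_path s) -> A (plain_path s')].
suff sub : @coord_filt R n X t `<=` C.
  move=> /sub CA s s' ss'; apply/idP/idP; rewrite !inE; apply: CA => //.
  by rewrite agree_sym.
apply: smallest_sub.
  split=> [s s' _ []|B CB s s' ss'|B CB s s' ss' [i _ Bi]].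
  - rewrite setTD => Bs; apply: contra_not Bs; apply: CB; by rewrite agree_sym.
  - by exists i => //; exact: CB Bi.
move=> _ [u /= ut [B mB <-]] s s' /agreeP ss' [_ /= Bs]; split=> //=.
by change (B (@f u (s' u))); rewrite -(ss' u ut).
Qed.

(** The atom of [s] at time [t], expressed through values; the injectivity of [f] makes values
    identify states. *)
Definition plain_cylinder (t : 'I_n.+1) (s : path) : set XX :=
  \bigcap_(u : 'I_n.+1)
    (if (u <= t)%N then @Defs.coord R n X u @^-1` [set f u (s u)] else setT).

Lemma coord_filt_cylinder t s : @coord_filt R n X t (plain_cylinder t s).
Proof.
have sF := @smallest_sigma_algebra _ [set: XX]
  (\bigcup_(u in [set u : 'I_n.+1 | (u <= t)%N]) gen_by (@Defs.coord R n X u)).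
apply: (@sub_bigcap_fin _ XX _ sF) => u; case: ifP => ut; last exact: (@sub_setT _ XX _ sF).
apply: sub_gen_smallest; exists u => //=.
by exists [set f u (s u)]; [exact: closed_borel1|rewrite setTI].
Qed.

Lemma mem_plain_cylinder t s s' : (plain_path s' \in plain_cylinder t s) = agree t s s'.
Proof.
apply/idP/agreeP => [|ss'].
  rewrite inE => h u ut; have := h u I; rewrite ut => /finj.
  by move=> ->.
rewrite inE => u _; case: ifP => // ut; rewrite /= /Defs.coord /plain_path.
by rewrite ss'.
Qed.

Lemma measurable_plain_path1 s : measurable [set plain_path s].
Proof.
rewrite (_ : [set _] = plain_cylinder ord_max s).
  exact: (@coord_filt_measurable R n X ord_max _ (coord_filt_cylinder (t := ord_max) s)).
apply/seteqP; split => [_ -> u _|w ws]; first by case: ifP.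
apply/functional_extensionality_dep => u; have := ws u I.
by rewrite (_ : (u <= _)%N)// -ltnS.
Qed.

End plain_process.

(** [Q] is carried by finitely many points, where [g] is at most the sum of its values there. *)
Lemma finite_support_integral (R : realType) d (T : measurableType d)
    (P : probability T R) (J : finType) d' (Z : measurableType d')
    (Q : probability Z R) (w : J -> T -> R) (emb : J -> Z) (g : Z -> R) :
  (forall D, Q D = (\sum_i \int[P]_(x in (fun=> emb i) @^-1` D) (w i x)%:E)%E) ->
  (forall i, measurable [set emb i]) -> (forall z, 0 <= g z) ->
  (\int[Q]_z (g z)%:E < +oo)%E.
Proof.
move=> QE memb g0; pose D := \bigcup_(i : J) [set emb i].
have mD : measurable D.
  by apply: (@sub_bigcup_fin _ Z _ (sigma_algebra_measurable _)) => i.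
have QD : Q D = 1%E.
  rewrite -(@probability_setT _ _ _ Q) !QE; apply: eq_bigr => i _.
  by rewrite preimage_setT (_ : _ @^-1` D = setT)//; apply/seteqP; split => // x _; exists i.
apply: (@le_lt_trans _ _ (\int[Q]_z (\sum_i g (emb i))%:E)%E); last first.
  by rewrite integral_cstT ltry.
apply: (@integral_le_ae_bound _ _ _ Q D) => //.
- by move=> z; rewrite lee_fin sumr_ge0.
- by move=> _ [i _ /= ->]; rewrite lee_fin (bigD1 i)//= lerDl sumr_ge0.
Qed.

(** * Choice of the constants *)

Section approximation.
Context (R : realType) (n : nat) (X : 'I_n.+1 -> polishMetricType R) (p : R).
Hypothesis p1 : 1 <= p.

(** Asking for [e / 2] makes the final inequality strict. *)
Lemma AW_lt (x y : filtered_process X)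
    (pi : probability (fp_space x * fp_space y)%type R) (e : R) :
  0 < e -> bicausal_coupling pi ->
  (\int[pi]_z (dist_p p (fp_path z.1) (fp_path z.2))%:E <= ((e / 2) `^ p)%:E)%E ->
  (AW x y p < e%:E)%E.
Proof.
move=> e0 bpi le; have p0 : 0 < p by apply: lt_le_trans p1.
have e2 : 0 <= e / 2 by rewrite divr_ge0// ltW.
have dist0 u v : 0 <= dist_p (X := X) p u v.
  by apply: sumr_ge0 => t _; exact: powR_ge0.
apply: (@le_lt_trans _ _ (((e / 2) `^ p)%:E `^ p^-1)%E).
  apply: gt0_ler_poweR; rewrite ?invr_ge0 ?(ltW p0)// ?in_itv/= ?leey ?andbT//.
  - by apply: le_ereal_inf_tmp => _ [pi' _ <-]; apply: integral_ge0 => z _; rewrite lee_fin.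
  - by rewrite lee_fin powR_ge0.
  - apply: le_trans le; apply: ereal_inf_lbound; by exists pi.
rewrite poweR_EFin -powRrM mulfV ?gt_eqF// powRr1// lte_fin; lra.
Qed.

Variable x : filtered_process X.
Local Notation T := (fp_space x).
Local Notation P := (fp_prob x).
Hypothesis moment : finite_moment p P (@fp_path _ _ _ x).
Hypothesis noiso : forall t, no_isolated_points (X t).

Lemma quantization_ex (e : R) : 0 < e ->
  exists (I : 'I_n.+1 -> finType) (v : forall t, I t -> X t) (r : forall t, T -> I t),
    (forall t, fin_measurable (fp_filt t) (r t)) /\
    (forall t, \int[P]_w (mdist (fp_proc t w) (v t (r t w)) `^ p)%:E <= e%:E)%E.
Proof.
move=> e0; have [x0 mx0] := moment.
have h t : exists (I : finType) (v : I -> X t) (r : T -> I),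
    fin_measurable (fp_filt t) r /\
    (\int[P]_w (mdist (fp_proc t w) (v (r w)) `^ p)%:E <= e%:E)%E.
  apply: (@base_quantization _ _ _ P _ (@fp_filt_sigma _ _ _ x t)
    (@fp_filt_measurable _ _ _ x t) (X t) (fp_proc t) p (x0 t)) => //.
    move=> B oB; apply: (fp_adapted (t := t)); exists B; last by rewrite setTI.
    exact: sub_gen_smallest.
  apply: le_lt_trans mx0; apply: ge0_le_integral_nomeas => w.
    by rewrite lee_fin powR_ge0.
  rewrite lee_fin /dist_p (bigD1 t)//= lerDl sumr_ge0// => u _.
  exact: powR_ge0.
pose I t := projT1 (cid (h t)).
pose v t : I t -> X t := projT1 (cid (projT2 (cid (h t)))).
pose r t : T -> I t := projT1 (cid (projT2 (cid (projT2 (cid (h t)))))).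
exists I, v, r; split=> t.
  exact: (projT2 (cid (projT2 (cid (projT2 (cid (h t))))))).1.
exact: (projT2 (cid (projT2 (cid (projT2 (cid (h t))))))).2.
Qed.

Lemma approximation (e : R) : 0 < e ->
  exists (M : nat) (f : forall t : 'I_n.+1, 'I_M.+1 -> X t)
    (k : nat -> 'I_M.+1 -> 'I_M.+1 -> R) (W : {ffun 'I_n.+1 -> 'I_M.+1} -> T -> R),
  [/\ forall t, injective (f t),
      (forall u i j, 0 <= k u i j) /\ (forall u i, (u < n)%N -> \sum_j k u i j = 1),
      [/\ forall s, measurable_fun setT (W s), forall s w, 0 <= W s w &
          forall w, \sum_s W s w = 1],
      forall t : nat, (t <= n)%N -> exists2 I : {ffun 'I_n.+1 -> 'I_M.+1} -> R,
        (forall s s', agree t s s' -> I s = I s') &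
        forall s, \int[P]_w W s w = I s * tail_weight k t s &
      forall (y : filtered_process X) (emb : {ffun 'I_n.+1 -> 'I_M.+1} -> fp_space y),
        (forall D, fp_prob y D =
          (\sum_s \int[P]_(w in (fun=> emb s) @^-1` D) (W s w)%:E)%E) ->
        (forall (t : 'I_n.+1) A, fp_filt t A -> forall s s', agree t s s' ->
          (emb s \in A) = (emb s' \in A)) ->
        (forall (t : 'I_n.+1) s, exists2 A, fp_filt t A &
          forall s', (emb s' \in A) = agree t s s') ->
        (forall t s, fp_proc t (emb s) = f t (s t)) ->
        (forall s, measurable [set emb s]) ->
        (AW x y p < e%:E)%E].
Proof.
move=> e0; have p0 : 0 < p by apply: lt_le_trans p1.
pose c := (e / 2) `^ p.
have c0 : 0 < c by rewrite powR_gt0// divr_gt0.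
have P20 : 0 < 2 `^ p :> R by rewrite powR_gt0.
pose N1 : R := n.+1%:R.
have N0 : 0 < N1 by rewrite ltr0n.
(* The bound of [mixture_cost] has three terms, each to be kept below [h]; 2^p times their sum then
   stays below [c]. *)
pose h := c / (2 `^ p * 4).
have h0 : 0 < h by rewrite divr_gt0// mulr_gt0.
have [I [v [r [mr rP]]]] := quantization_ex (divr_gt0 h0 N0).
(* A bound for all distances between quantization points, with an extra 1 for the later
   perturbation. It does not involve the chain, so [dl] may depend on it. *)
pose B := \sum_(t < n.+1) \sum_(i : I t) \sum_(j : I t) (mdist (v t i) (v t j) + 1).
have vB t i j : mdist (v t i) (v t j) + 1 <= B.
  have d0 t' i' j' : 0 <= mdist (v t' i') (v t' j') + 1 by rewrite addr_ge0 ?mdist_ge0.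
  rewrite /B (bigD1 t)//= (bigD1 i)//= (bigD1 j)//= -!addrA lerD2l lerDl.
  by rewrite !addr_ge0// !sumr_ge0// => *; rewrite ?sumr_ge0// => *; rewrite ?sumr_ge0.
pose D := B `^ p.
have D0 : 0 <= D by exact: powR_ge0.
(* Chosen for [dlD]; [D + 1] and [N1] in place of [D] and [n] keep the denominator positive. *)
pose dl := Num.min 1 (h / (N1 * (D + 1) * N1)).
have D1 : 0 < D + 1 by rewrite ltr_wpDl.
have dl01 : 0 < dl <= 1.
  by rewrite lt_min ltr01/= ge_min lexx/= divr_gt0// !mulr_gt0.
have dlD : N1 * D * (n%:R * dl) <= h.
  have dlh : dl * (N1 * (D + 1) * N1) <= h.
    by rewrite -ler_pdivlMr ?mulr_gt0// ge_min lexx orbT.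
  apply: le_trans dlh; rewrite [leRHS]mulrC mulrA.
  have /andP[dl0 _] := dl01.
  rewrite ler_wpM2r ?(ltW dl0)// -mulrA -mulrA ler_wpM2l ?(ltW N0)//.
  by rewrite ler_pM// ?ler_nat// lerDl.
have [M [q [rho [k [a [mq rhoE [k0 k1] [ma a0 a1 aP] ka]]]]]] := chain_ex mr dl01.
(* The bound 1 serves [far]; the other serves [near], whose cost is paid at each of the [n.+1]
   times. *)
pose ep := Num.min 1 ((h / N1) `^ p^-1).
have ep0 : 0 < ep by rewrite lt_min ltr01/= powR_gt0// divr_gt0.
have [f finj fv] : exists2 f : forall t : 'I_n.+1, 'I_M.+1 -> X t,
    forall t, injective (f t) & forall t i, mdist (v t (rho t i)) (f t i) < ep.
  have g t := cid2 (perturb_injective (noiso t) (fun i => v t (rho t i)) ep0).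
  by exists (fun t => s2val (g t)) => t; [exact: (s2valP (g t))|exact: (s2valP' (g t))].
have dlb : 0 <= dl <= 1 by have /andP[/ltW -> ->] := dl01.
pose W (s : {ffun 'I_n.+1 -> 'I_M.+1}) w := weight q k a dl n w s.
have mW s : measurable_fun setT (W s).
  exact: (measurable_weight (@filt_nat_sigma _ _ _ x) (@filt_nat_measurable _ _ _ x)
    (@filt_nat_mono _ _ _ x)).
have W0 s w : 0 <= W s w.
  by have /andP[] := weight_bounds k0 k1 a1 dlb ka w s (leqnn n).
have W1 w : \sum_s W s w = 1 by exact: weight_sum.
exists M, f, k, W; split=> //.
  move=> t tn; exists (fun s => \int[P]_w weight q k a dl t w s) => [s s' ss'|s].
    by apply: eq_Rintegral => w _; exact: weight_agree.
  apply: (Rintegral_weight_tail (@filt_nat_sigma _ _ _ x) (@filt_nat_measurable _ _ _ x)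
    (@filt_nat_mono _ _ _ x)) => //.
  exact: (@sub_setT _ T _ (@filt_nat_sigma _ _ _ x t)).
move=> y emb yP yF yC procE memb.
have [pi piE] := @mixture_ex _ _ _ P _ _ (T * fp_space y)%type
  (fun s w => (w, emb s)) W (fun s => pair2_measurable (emb s)) mW W0 W1.
apply: (AW_lt (pi := pi)) => //.
  exact: (mixture_bicausal mq k0 k1 ma a0 a1 aP dlb ka yP yF yC piE).
have mdq t : measurable_fun setT
    (fun w => mdist (fp_proc t w) (v t (rho t (q t w))) `^ p).
  under eq_fun do rewrite rhoE.
  apply: (measurable_quantized (@fp_filt_sigma _ _ _ x t)
    (@fp_filt_measurable _ _ _ x t)) => // B' oB.
  apply: (fp_adapted (t := t)); exists B'; last by rewrite setTI.
  exact: sub_gen_smallest.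
have mcost : measurable_fun setT (quantization_cost q p (fun t i => v t (rho t i))).
  exact: measurable_sum.
have cost : (\int[P]_w (quantization_cost q p (fun t i => v t (rho t i)) w)%:E
    <= h%:E)%E.
  rewrite /quantization_cost; under eq_integral do rewrite -sumEFin.
  rewrite ge0_integral_sum//; last 2 first.
  - by move=> t; apply/measurable_EFinP.
  - by move=> t w _; rewrite lee_fin powR_ge0.
  apply: (@le_trans _ _ (\sum_(t < n.+1) (h / N1)%:E)%E).
    by apply: lee_sum => t _; under eq_integral do rewrite rhoE; exact: rP.
  by rewrite sumEFin lee_fin sumr_const card_ord -mulr_natr divfK// gt_eqF.
have near t i : mdist (v t (rho t i)) (f t i) `^ p <= h / N1.
  apply: (@le_trans _ _ (((h / N1) `^ p^-1) `^ p)).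
    rewrite ge0_ler_powR ?nnegrE ?mdist_ge0 ?powR_ge0 ?(ltW p0)//.
    by rewrite (le_trans (ltW (fv t i)))// ge_min lexx orbT.
  by rewrite -powRrM mulVf ?gt_eqF// powRr1// divr_ge0// ltW.
have far t i j : mdist (v t (rho t i)) (f t j) `^ p <= D.
  rewrite ge0_ler_powR ?nnegrE ?mdist_ge0 ?(ltW p0)//.
    by apply: le_trans (vB t (rho t i) (rho t j)); rewrite addr_ge0 ?mdist_ge0.
  apply: le_trans (vB t (rho t i) (rho t j)).
  apply: (le_trans (metric_triangle _ (v t (rho t j)) _)); rewrite lerD2l.
  by rewrite (le_trans (ltW (fv t j)))// ge_min lexx.
have := mixture_cost mq k0 k1 ma a1 dlb ka yP piE p1 procE memb
  mcost cost near far.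
move=> /le_trans; apply; rewrite -/c.
rewrite lee_fin -/N1 mulrCA mulfV ?gt_eqF// mulr1.
apply: (@le_trans _ _ (2 `^ p * (h * 4))).
  by rewrite ler_wpM2l ?(ltW P20)//; lra.
rewrite [leLHS](_ : _ = c)// /h; field.
by rewrite gt_eqF.
Qed.

End approximation.

Theorem theorem5p4 (R : realType) (n : nat) (p : R)
    (X : 'I_n.+1 -> polishMetricType R) (p1 : 1 <= p)
    (noiso : forall t, no_isolated_points (X t)) :
  AW_dense (@finite_markov R n X p) /\ AW_dense (@Lambda_plain R n X p).
Proof.
have dist0 u v : 0 <= dist_p (X := X) p u v.
  by apply: sumr_ge0 => t _; exact: powR_ge0.
split=> -[x mx] e e0;
  have [M [f [k [W [finj [k0 k1] [mW W0 W1] muE approx]]]]] := approximation p1 mx noiso e0.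
(* The finite process is the chain on its own path space, embedded by the identity. *)
- have [Q QE] := @mixture_ex _ _ _ (fp_prob x) _ _ (path_space n M)
    (fun s => cst (s : path_space n M)) W (fun=> measurable_cst _) mW W0 W1.
  pose y := finite_process f Q.
  have my : finite_moment p (fp_prob y) (@fp_path _ _ _ y).
    exists point.
    exact: (@finite_support_integral _ _ _ (fp_prob x) _ _ (path_space n M) Q W
      (fun s => s) (fun w => dist_p p (@fp_path _ _ _ y w) point) QE).
  exists (exist _ y my); split.
    exists (exist _ y my); split=> //=; last exact: finite_process_finite.
    apply: (@finite_process_markov _ _ _ _ _ _ (fun s => \int[fp_prob x]_w W s w) k) => //.
    move=> D; rewrite (@mixture_fin _ _ _ (fp_prob x) _ _ (path_space n M)
      (fun s => cst (s : path_space n M)) W (fun=> measurable_cst _) mW W0 W1 Q D QE) //.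
    congr EFin; rewrite [RHS]big_mkcond; apply: eq_bigr => s _; case: ifPn => sD.
      congr (Rintegral _ _ _); apply/seteqP; split => // w _; exact: set_mem.
    rewrite (_ : _ @^-1` _ = set0) ?Rintegral_set0//.
    by apply/seteqP; split => // w /= Ds; move: sD; rewrite mem_set.
  apply: (approx y (fun s => s)) => //=.
  + move=> t A FA s s' ss'; apply/idP/idP; rewrite !inE; apply: FA => //.
    by rewrite agree_sym.
  + move=> t s; exists [set s' | agree t s s'].
      by move=> s1 s2 s12 /= ss1; exact: agree_trans s12.
    move=> s'; apply/idP/idP; rewrite ?inE //= => h; by rewrite inE.
(* The plain process has the law of the chain's values, and its filtration sees the atoms of the
   chain through the cylinders. *)
- have [Q QE] := @mixture_ex _ _ _ (fp_prob x) _ _ (borel (prod_topology X))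
    (fun s => cst (plain_path f s)) W (fun=> measurable_cst _) mW W0 W1.
  have PQ : calP p Q.
    exists point.
    apply: (@finite_support_integral _ _ _ (fp_prob x) _ _ (borel (prod_topology X)) Q W
      (plain_path f) (fun w => dist_p p w point) QE) => // s.
    exact: measurable_plain_path1.
  exists (plain_calFP PQ); split; first by exists Q, PQ.
  apply: (approx (plain Q) (plain_path f)) => //=.
  + exact: coord_filt_agree.
  + move=> t s; exists (plain_cylinder f t s); first exact: coord_filt_cylinder.
    by move=> s'; exact: mem_plain_cylinder.
  + exact: measurable_plain_path1.
Qed.
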